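(* Let $K$ be a triangulated polygon in $\mathbb{R}^2$, homeomorphic to a disc $D$, with possible identifications of the simplices in the boundary of $K$. Let $K_0$ denote the boundary of $K$ with these identifications. Then $$\chi(K) = \chi(K_0) + 1,$$ where $\chi(K)$ and $\chi(K_0)$ are computed taking the identifications into account.
   Context: A finite simplicial complex of dimension 2 is a finite set of simplices (triangles, edges, vertices) such that every face of a simplex belongs to the set, and the intersection of any two simplices is either empty or a common face of both. A triangulated polygon $K$ is a polygonal region in $\mathbb{R}^2$ that is the union of the simplices of such a complex. The identifications concern only simplices (vertices and edges) in the boundary of the polygon: these simplices are named and oriented, and simplices with the same name are identified, respecting orientation (boundary vertices may be identified with boundary vertices, and boundary edges with boundary edges; identifying two oriented edges identifies their initial vertices with each other and their terminal vertices with each other). There may be no identifications at all. For $X = K$ or $X = K_0$, $\chi(X) = n_0 - n_1 + n_2$, where $n_0$, $n_1$, $n_2$ are the numbers of vertices, edges and triangles of $X$, simplices that are identified being counted only once. For $K_0$ one has $n_2 = 0$. *)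

(* Defs.v *)
From HB Require Import structures.
From mathcomp Require Import all_boot all_order all_algebra finmap.
From mathcomp Require Import all_classical all_reals.
From mathcomp Require Import topology normedtype.

Set Implicit Arguments.
Unset Strict Implicit.
Unset Printing Implicit Defensive.

Import Order.TTheory GRing.Theory Num.Theory numFieldNormedType.Exports.

Local Open Scope fset_scope.
Local Open Scope classical_set_scope.
Local Open Scope ring_scope.

Notation plane R := 'rV[R]_2.

(* A simplex is represented by the finite set of its vertices; the
   corresponding subset of the plane is [hull s]. *)
Notation simplex R := {fset 'rV[R]_2}.

Section Complexes.
Variable R : realType.
Implicit Types (s t u : simplex R) (K X : {fset (simplex R)}).

Definition affinely_independent s : Prop :=
  forall c : plane R -> R,
    \sum_(v <- s) c v = 0 -> \sum_(v <- s) c v *: v = 0 ->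
    forall v, v \in s -> c v = 0.

Definition hull s : set (plane R) :=
  [set x | exists c : plane R -> R,
     [/\ forall v, v \in s -> 0 <= c v,
         \sum_(v <- s) c v = 1
       & x = \sum_(v <- s) c v *: v]].

Definition is_complex K : Prop :=
  [/\ forall s, s \in K ->
        [/\ s != fset0, (#|` s| <= 3)%N & affinely_independent s],
      forall s t, s \in K -> t != fset0 -> (t `<=` s)%fset -> t \in K
    & forall s t, s \in K -> t \in K ->
        hull s `&` hull t = set0 \/
        exists u, [/\ u != fset0, (u `<=` s)%fset, (u `<=` t)%fset
                    & hull s `&` hull t = hull u]].

Definition body K : set (plane R) :=
  [set x | exists2 s, s \in K & hull s x].

(* The norm of ['rV[R]_2] is the sup norm, so [closed_ball] would be a
   square; this is the Euclidean closed unit disc. *)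
Definition disc : set (plane R) :=
  [set x | x 0 0 ^+ 2 + x 0 1 ^+ 2 <= 1].

Definition homeomorphic (A B : set (plane R)) : Prop :=
  exists f g : plane R -> plane R,
    [/\ set_fun A B f, set_fun B A g,
        {in A, cancel f g} /\ {in B, cancel g f},
        {within A, continuous f} & {within B, continuous g}].

Definition frontier (A : set (plane R)) : set (plane R) :=
  closure A `\` interior A.

(* An edge whose two end points are in the frontier may cross the interior
   of the polygon: the whole simplex has to lie in the frontier. *)
Definition boundary K : {fset (simplex R)} :=
  [fset s in K | `[< hull s `<=` frontier (body K) >]].

Section Identifications.
Variables (K : {fset (simplex R)}) (N : Type).
Variables (name : simplex R -> N) (tail head : simplex R -> plane R).

Definition boundary_edge s : Prop := s \in boundary K /\ #|` s| = 2%N.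

Definition is_orientation : Prop :=
  forall s, boundary_edge s -> s = [fset tail s; head s].

(* The equivalence relation generated by the names.  Only [id_name] relates
   simplices other than vertices; [id_tail] and [id_head] are the
   identifications of vertices forced by those of oriented edges. *)
Inductive identified : simplex R -> simplex R -> Prop :=
| id_refl s : identified s s
| id_sym s t : identified s t -> identified t s
| id_trans s t u : identified s t -> identified t u -> identified s u
| id_name s t : s \in boundary K -> t \in boundary K -> #|` s| = #|` t| ->
    name s = name t -> identified s t
| id_tail s t : boundary_edge s -> boundary_edge t -> name s = name t ->
    identified [fset tail s] [fset tail t]
| id_head s t : boundary_edge s -> boundary_edge t -> name s = name t ->
    identified [fset head s] [fset head t].

(* [K] fixes the identifications, [X] is the subcomplex being counted. *)
Definition nb_simplices X (d : nat) : nat :=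
  #|` [fset [set t | identified s t] | s in X & #|` s| == d.+1]|.

Definition euler_char X : int :=
  (nb_simplices X 0)%:Z - (nb_simplices X 1)%:Z + (nb_simplices X 2)%:Z.

End Identifications.
End Complexes.

Arguments disc : clear implicits.

(* Main.v *)
Require Import Defs.
From mathcomp Require Import all_boot all_order all_algebra finmap.
From mathcomp Require Import all_classical all_reals.
From mathcomp Require Import topology normedtype.
From mathcomp Require Import ring lra zify.

Set Implicit Arguments.
Unset Strict Implicit.
Unset Printing Implicit Defensive.

Import Order.TTheory GRing.Theory Num.Theory numFieldNormedType.Exports.

Local Open Scope classical_set_scope.
Local Open Scope ring_scope.

(** Only simplices of the boundary are identified, so the claim amounts to
    [n0 - n1 + n2 = 1] for the numbers of vertices, edges and triangles that
    are not in the boundary ([nb_simplices_split], [interior_count]). These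
    simplices span, modulo 2, the relative chain complex
    [C_2 -> C_1 -> C_0] of the pair (body, boundary), and [exact_count] yields
    the value 1 from three facts.

    - A chain of triangles with boundary zero is constant, and there is a
      triangle ([cycle_constant], [triangle_exists]): a disc minus finitely
      many points is connected, and a set of triangles closed under crossing
      interior edges is clopen in the body minus the vertices.
    - The map to [C_0] is onto. Dually, a function on interior vertices,
      extended by 0 to the boundary, that is constant along interior edges
      vanishes ([coboundary_injective]): look at the vertex of its support
      with the largest first coordinate.
    - A chain [z] of interior edges with even degree at every interior vertex
      bounds a chain of triangles ([cycle_bounds]). Around each vertex it does
      ([local_potential]), because the punctured ball is connected
      ([star_transitive]). The differences of the local solutions form a
      1-cocycle of the complex, and 1-cocycles are coboundaries since the body
      is a disc ([cocycle_coboundary]): they define a covering of the disc,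
      which has a section, as one sees by gluing over small rectangles
      ([trivial_convex]).

    The plane enters through the sign of the area of [a b c]: an edge outside
    the boundary lies in exactly two triangles, one on each side, and these
    cover a neighbourhood of its open segment ([interior_edge_triangles]). *)

(** * Connected sets *)

(** The clopen argument in the form used throughout: membership in [B] and in
    its complement are both stable under small moves inside [A]. *)
Lemma connected_clopen (T : topologicalType) (A B : set T) :
  connected A -> (exists2 p, A p & B p) ->
  (forall p, A p -> B p -> \forall q \near p, A q -> B q) ->
  (forall p, A p -> ~ B p -> \forall q \near p, A q -> ~ B q) ->
  A `<=` B.
Proof.
move=> cA [p0 Ap0 Bp0] Bopen Bclosed.
suff <- : A `&` B = A by move=> x [].
apply: cA; first by exists p0.
- exists (interior [set q | A q -> B q]); first exact: open_interior.
  apply/seteqP; split=> x /=.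
    by move=> [Ax Bx]; split => //; apply: Bopen.
  by move=> [Ax /interior_subset Bx]; split => //; apply: Bx.
- exists (~` interior [set q | A q -> ~ B q]).
    exact/open_closedC/open_interior.
  apply/seteqP; split=> x /=.
    by move=> [Ax Bx]; split => // /interior_subset /= /(_ Ax); apply.
  move=> [Ax nBx]; split => //; apply: contrapT => Bx.
  by apply: nBx; apply: Bclosed.
Qed.

Lemma locally_constant_connected (T : topologicalType) (U : Type)
    (A : set T) (g : T -> U) :
  connected A -> (forall p, A p -> \forall q \near p, A q -> g q = g p) ->
  forall p q, A p -> A q -> g p = g q.
Proof.
move=> cA gA p q Ap; move: q.
suff : A `<=` [set q | g p = g q] by [].
apply: connected_clopen => //=; first by exists p.
- move=> r Ar gpr; apply: filterS (gA _ Ar) => s H As.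
  by rewrite H.
- move=> r Ar gpr; apply: filterS (gA _ Ar) => s H As.
  by rewrite H.
Qed.

Lemma connected_joined (T : topologicalType) (A : set T) :
  (forall p q, A p -> A q -> exists C, [/\ connected C, C `<=` A, C p & C q]) ->
  connected A.
Proof.
move=> HA B [p Bp] [C oC BE] [D cD BE'].
have BA : B `<=` A by rewrite BE; apply: subIsetl.
apply/seteqP; split=> // q Aq.
have [Z [cZ ZA Zp Zq]] := HA p q (BA _ Bp) Aq.
suff : Z `<=` B by apply.
suff <- : Z `&` B = Z by move=> x [].
apply: cZ; first by exists p.
- by exists C => //; rewrite BE setIA (setIidl ZA).
- by exists D => //; rewrite BE' setIA (setIidl ZA).
Qed.

(** * Convex subsets of the plane *)

Section Plane.
Variable R : realType.
Notation plane := 'rV[R]_2.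
Implicit Types (p q r x y : plane) (A B : set plane).

Definition seg p q : set plane := (fun t : R => p + t *: (q - p)) @` `[0, 1].

Definition is_convex A := forall p q, A p -> A q -> seg p q `<=` A.

Lemma seg_l p q : seg p q p.
Proof. by exists 0; [rewrite /= in_itv /= lexx ler01|rewrite scale0r addr0]. Qed.

Lemma seg_r p q : seg p q q.
Proof.
by exists 1; [rewrite /= in_itv /= lexx ler01|rewrite scale1r addrC subrK].
Qed.

Lemma line_continuous p q : continuous (fun t : R => p + t *: q).
Proof. by move=> t; apply: cvgD; [exact: cvg_cst|apply: cvgZr_tmp; exact: cvg_id]. Qed.

Lemma seg_connected p q : connected (seg p q).
Proof.
apply: connected_continuous_connected; first exact: segment_connected.
exact/continuous_subspaceT/line_continuous.
Qed.

Lemma convex_connected A : is_convex A -> connected A.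
Proof.
move=> cA; apply: connected_joined => p q Ap Aq; exists (seg p q).
by split; [exact: seg_connected|exact: cA|exact: seg_l|exact: seg_r].
Qed.

Lemma ord2P (i : 'I_2) : i = 0 \/ i = 1.
Proof. by case: i => [[|[|//]] Hi]; [left|right]; apply/val_inj. Qed.

Lemma plane_eq x y : x 0 0 = y 0 0 -> x 0 1 = y 0 1 -> x = y.
Proof.
by move=> h0 h1; apply/rowP => i; case: (ord2P i) => ->.
Qed.

Lemma sqdist_gt0 p q : p <> q ->
  0 < (q 0 0 - p 0 0) ^+ 2 + (q 0 1 - p 0 1) ^+ 2.
Proof.
move=> pq; rewrite lt_neqAle eq_sym addr_ge0 ?sqr_ge0 // andbT.
rewrite paddr_eq0 ?sqr_ge0 // !sqrf_eq0 !subr_eq0.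
by apply/negP => /andP[/eqP h0 /eqP h1]; apply: pq; apply: plane_eq.
Qed.

Lemma line_coord p q (t : R) i :
  (p + t *: (q - p)) 0 i = p 0 i + t * (q 0 i - p 0 i).
Proof. by rewrite !mxE. Qed.

Lemma avoid_finite (s : seq R) (e : R) : 0 < e -> exists2 t, 0 < t < e & t \notin s.
Proof.
move=> e0.
suff [d /andP[d0 de] ds] : exists2 d, 0 < d <= e & forall t, 0 < t < d -> t \notin s.
  have hd : 0 < d / 2 < d by apply/andP; split; lra.
  by exists (d / 2); [lra|exact: ds].
elim: s => [|a s [d /andP[d0 de] ds]]; first by exists e => //; rewrite e0 lexx.
have [a0|a0] := ltP 0 a.
  exists (Num.min d a); first by rewrite lt_min d0 a0 ge_min de.
  move=> t; rewrite lt_min => /and3P[t0 td ta].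
  by rewrite inE negb_or (lt_eqF ta) ds // t0.
exists d; first by rewrite d0.
move=> t /andP[t0 td]; rewrite inE negb_or ds ?t0 // andbT.
by apply/eqP => ta; rewrite ta in t0; lra.
Qed.

(** Two points [p], [q] are joined by the two-segment paths through the points
    [(p + q) / 2 + t J] with [J] normal to [q - p]; two such paths meet only in
    [p] and [q], so that all but finitely many of them avoid [F]. *)
Lemma convex_minus_finite_connected A (F : seq plane) :
  is_convex A ->
  (forall p q, A p -> A q -> p <> q -> interior A (2^-1 *: (p + q))) ->
  connected (A `\` [set` F]).
Proof.
move=> cA mA; apply: connected_joined => p q [Ap /= /negP nFp] [Aq /= /negP nFq].
have [->|/eqP pq] := eqVneq p q.
  exists [set q]; split => //; first exact: connected1.
  by move=> _ ->; split => //; exact/negP.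
pose d0 := q 0 0 - p 0 0; pose d1 := q 0 1 - p 0 1.
pose J : plane := \row_i (if i == 0 then - d1 else d0).
have J0 : J 0 0 = - d1 by rewrite mxE.
have J1 : J 0 1 = d0 by rewrite mxE.
pose r (t : R) : plane := 2^-1 *: (p + q) + t *: J.
have d_gt0 : 0 < d0 ^+ 2 + d1 ^+ 2 by exact: sqdist_gt0.
have [N NE] : exists N, N = d0 ^+ 2 + d1 ^+ 2 by eexists.
rewrite -NE in d_gt0.
have [e e0 He] : exists2 e, 0 < e & forall t, 0 < t < e -> A (r t).
  have : \forall t \near (0 : R), A (r t).
    have := @line_continuous (2^-1 *: (p + q)) J 0; apply.
    by rewrite scale0r addr0; exact: mA.
  move/nbhs_ballP => [e /= e0 He]; exists e => // t /andP[t0 te].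
  by apply: He; rewrite /ball /= sub0r normrN gtr0_norm.
pose ip (f c : plane) := (f 0 0 - c 0 0) * d0 + (f 0 1 - c 0 1) * d1.
pose iJ (f c : plane) := - (f 0 0 - c 0 0) * d1 + (f 0 1 - c 0 1) * d0.
(* a path through [r t] meets [f] for at most the two parameters listed here *)
have [t tI] := avoid_finite
  ([seq iJ f p / (2 * ip f p) | f <- F] ++ [seq - iJ f q / (2 * ip f q) | f <- F]) e0.
rewrite mem_cat negb_or => /andP[tp tq].
have Ar := He t tI.
have r0 : r t 0 0 = 2^-1 * (p 0 0 + q 0 0) - t * d1.
  by rewrite /r !mxE eqxx mulrN.
have r1 : r t 0 1 = 2^-1 * (p 0 1 + q 0 1) + t * d0.
  by rewrite /r !mxE.
exists (seg p (r t) `|` seg (r t) q); split; last 2 first.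
- by left; exact: seg_l.
- by right; exact: seg_r.
- apply: connectedU; try exact: seg_connected.
  by exists (r t); split; [exact: seg_r|exact: seg_l].
- move=> f Hf; split; first by case: Hf; apply: cA.
  move=> /= fF; case: Hf => -[s _ fE].
  + move/negP: tp; apply; apply/mapP; exists f => //.
    have f0 : f 0 0 - p 0 0 = s * (d0 / 2 - t * d1).
      by rewrite -fE line_coord r0 /d0 /d1; field.
    have f1 : f 0 1 - p 0 1 = s * (d1 / 2 + t * d0).
      by rewrite -fE line_coord r1 /d0 /d1; field.
    have s0 : s != 0.
      apply/eqP => s0; move/negP: nFp; apply; suff -> : p = f by [].
      by rewrite -fE s0 scale0r addr0.
    have -> : iJ f p = s * t * N by rewrite /iJ f0 f1 NE; field.
    have -> : ip f p = s * N / 2 by rewrite /ip f0 f1 NE; field.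
    by field; rewrite s0 gt_eqF.
  + move/negP: tq; apply; apply/mapP; exists f => //.
    have f0 : f 0 0 - q 0 0 = (1 - s) * (- d0 / 2 - t * d1).
      by rewrite -fE line_coord r0 /d0 /d1; field.
    have f1 : f 0 1 - q 0 1 = (1 - s) * (- d1 / 2 + t * d0).
      by rewrite -fE line_coord r1 /d0 /d1; field.
    have s0 : 1 - s != 0.
      apply/eqP => s0; move/negP: nFq; apply; suff -> : q = f by [].
      by apply/plane_eq; apply/eqP; rewrite eq_sym -subr_eq0 ?f0 ?f1 s0 mul0r.
    have -> : iJ f q = (1 - s) * t * N by rewrite /iJ f0 f1 NE; field.
    have -> : ip f q = - ((1 - s) * N / 2) by rewrite /ip f0 f1 NE; field.
    by field; rewrite s0 gt_eqF.
Qed.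

Lemma coord_cts (i : 'I_2) : continuous (fun x : plane => x 0 i).
Proof. exact: coord_continuous. Qed.

Definition rect (a b c d : R) : set plane :=
  [set x | [/\ a <= x 0 0, x 0 0 <= b, c <= x 0 1 & x 0 1 <= d]].

Lemma affine_cts (a b c : R) :
  continuous (fun x : plane => a * x 0 0 + b * x 0 1 + c).
Proof.
move=> x; have h i := @coord_cts i x.
exact (cvgD (cvgD (cvgM (cvg_cst a) (h 0)) (cvgM (cvg_cst b) (h 1))) (cvg_cst c)).
Qed.

Lemma near_fun_lt (f : plane -> R) (a : R) x :
  continuous f -> f x < a -> \forall y \near x, f y < a.
Proof. by move=> cf; exact (@cvgr_lt _ _ _ _ f (f x) (cf x) a). Qed.

Lemma near_fun_gt (f : plane -> R) (a : R) x :
  continuous f -> a < f x -> \forall y \near x, a < f y.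
Proof. by move=> cf; exact (@cvgr_gt _ _ _ _ f (f x) (cf x) a). Qed.

Lemma closed_fun_le (f : plane -> R) (a : R) :
  continuous f -> closed [set x | f x <= a].
Proof. by move=> cf; apply: (@closed_comp _ _ f [set y | y <= a]) => [x _|]; [exact: cf|exact: closed_le]. Qed.

Lemma rect_convex a b c d : is_convex (rect a b c d).
Proof.
move=> p q [p0 p0' p1 p1'] [q0 q0' q1 q1'] x [t]; rewrite /= in_itv /= => /andP[t0 t1] <-.
by split; rewrite !mxE; nra.
Qed.

Lemma rect_closed a b c d : closed (rect a b c d).
Proof.
have -> : rect a b c d = [set x | - x 0 0 <= - a] `&` [set x | x 0 0 <= b]
    `&` ([set x | - x 0 1 <= - c] `&` [set x | x 0 1 <= d]).
  apply/seteqP; split => x /=; first by case=> *; rewrite !lerN2.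
  by rewrite !lerN2 => -[[? ?] [? ?]]; split.
have cl i (e : R) : closed [set x : plane | x 0 i <= e].
  exact: (@closed_fun_le (fun x => x 0 i) e (@coord_cts i)).
have cg i (e : R) : closed [set x : plane | - x 0 i <= e].
  apply: (@closed_fun_le (fun x => - x 0 i) e) => x.
  exact/continuousN/coord_cts.
by apply: closedI; apply: closedI; first [exact: cl|exact: cg].
Qed.

Lemma disc_convex : is_convex (disc R).
Proof.
move=> p q; rewrite /disc /= => Hp Hq x [t]; rewrite /= in_itv /= => /andP[t0 t1] <-.
rewrite !mxE; move: (p 0 0) (p 0 1) (q 0 0) (q 0 1) Hp Hq => a b c d Hp Hq.
have hp : (1 - t) * (a ^+ 2 + b ^+ 2) <= 1 - t by rewrite ler_piMr // subr_ge0.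
have hq : t * (c ^+ 2 + d ^+ 2) <= t by rewrite ler_piMr.
have hd : 0 <= t * (1 - t) * ((a - c) ^+ 2 + (b - d) ^+ 2).
  by rewrite !mulr_ge0 ?subr_ge0 // addr_ge0 ?sqr_ge0.
lra.
Qed.

Lemma norm2_cts : continuous (fun x : plane => x 0 0 ^+ 2 + x 0 1 ^+ 2).
Proof.
move=> x; have h i := @coord_cts i x.
exact (cvgD (cvgM (h 0) (h 0)) (cvgM (h 1) (h 1))).
Qed.

Lemma disc_closed : closed (disc R).
Proof. exact: (@closed_fun_le _ 1 norm2_cts). Qed.

Lemma disc_midpoint p q : disc R p -> disc R q -> p <> q ->
  interior (disc R) (2^-1 *: (p + q)).
Proof.
move=> Hp Hq pq.
suff : (2^-1 *: (p + q)) 0 0 ^+ 2 + (2^-1 *: (p + q)) 0 1 ^+ 2 < 1.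
  by move/(near_fun_lt norm2_cts); apply: filterS => x /ltW.
rewrite !mxE.
have := sqdist_gt0 pq.
move: Hp Hq; rewrite /disc /=.
by move: (p 0 0) (p 0 1) (q 0 0) (q 0 1) => a b c d *; lra.
Qed.

Lemma disc_minus_finite_connected (F : seq plane) :
  connected (disc R `\` [set` F]).
Proof.
exact: (convex_minus_finite_connected disc_convex disc_midpoint).
Qed.

Lemma ball_convex x (e : R) : is_convex (ball x e).
Proof.
move=> p q; rewrite -!ball_normE /= => Hp Hq z [t].
rewrite /= in_itv /= => /andP[t0 t1] <-.
have -> : x - (p + t *: (q - p)) = (1 - t) *: (x - p) + t *: (x - q).
  by apply/rowP => i; rewrite !mxE; ring.
apply: (le_lt_trans (ler_normD _ _)).
rewrite !normrZ (ger0_norm t0) ger0_norm ?subr_ge0 //.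
have [->|t_neq0] := eqVneq t 0; first by rewrite subr0 mul1r mul0r addr0.
have : 0 < t by rewrite lt_neqAle eq_sym t_neq0.
move: `|x - p| `|x - q| Hp Hq => u v *.
by nra.
Qed.

Lemma punctured_ball_connected x (e : R) : connected (ball x e `\` [set x]).
Proof.
have -> : [set x] = [set` [:: x]].
  by apply/seteqP; split => y /=; rewrite inE => /eqP.
apply: convex_minus_finite_connected; first exact: ball_convex.
move=> p q Hp Hq _.
have bo : open (ball x e) by exact: ball_open.
apply: bo; have -> : 2^-1 *: (p + q) = p + 2^-1 *: (q - p).
  by apply/rowP => i; rewrite !mxE; field.
apply: (ball_convex Hp Hq); exists 2^-1 => //=.
by rewrite in_itv /=; apply/andP; split; lra.
Qed.

End Plane.

(** * Triviality of locally constant data on a closed convex plane set *)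

(** Continuous induction: consider the supremum of the [x] with [P a x]. *)
Lemma interval_subdivision (R : realType) (P : R -> R -> Prop) (a b : R) :
  a <= b ->
  (forall x, a <= x <= b -> exists2 e, 0 < e &
     forall s t, s <= t -> x - e < s -> t < x + e -> P s t) ->
  (forall s t u, s <= t -> t <= u -> P s t -> P t u -> P s u) ->
  P a b.
Proof.
move=> ab loc glue.
pose Z := [set x | a <= x <= b /\ P a x].
have Za : Z a.
  split; first by rewrite lexx ab.
  have [|e e0] := loc a; first by rewrite lexx ab.
  by apply => //; [rewrite ltrBlDr ltrDl|rewrite ltrDl].
have supZ : has_sup Z by split; [exists a|exists b => x [/andP[]]].
have am : a <= sup Z by apply: sup_upper_bound.
have mb : sup Z <= b by apply: ge_sup; [exists a|move=> x [/andP[]]].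
have [|e e0 He] := loc (sup Z); first by rewrite am mb.
have [x [/andP[ax xb] Pax] xm] := sup_adherent e0 supZ.
have xs : x <= sup Z by apply: sup_upper_bound => //; split=> //; rewrite ax xb.
pose y := Num.min b (sup Z + e / 2).
have sy : sup Z <= y by rewrite le_min mb lerDl divr_ge0 // ltW.
have yb : y <= b by rewrite ge_min lexx.
have yse : y <= sup Z + e / 2 by rewrite ge_min lexx orbT.
have Pxy : P x y by apply: He; lra.
have Pay : P a y by apply: glue Pax Pxy => //; lra.
have ys : y <= sup Z.
  by apply: sup_upper_bound => //; split => //; rewrite yb andbT; lra.
suff <- : y = b by [].
move: ys; rewrite /y minEle; case: ifP => // _; lra.
Qed.

Section Cocycle.
Variables (R : realType) (V : Type) (G : zmodType).
Notation plane := 'rV[R]_2.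
Variables (D : set plane) (S : V -> set plane) (c : V -> V -> G).
Hypothesis S_open : forall v p, D p -> S v p -> \forall q \near p, D q -> S v q.
Hypothesis S_cover : forall p, D p -> exists v, S v p.
Hypothesis c_cocycle : forall u v w p, D p -> S u p -> S v p -> S w p ->
  c u w = c u v + c v w.

(** The functions [h v] are the local branches of a section of the covering
    with fibre [G] and transition functions [c] over the open cover [S]. *)
Definition is_section (B : set plane) (h : V -> plane -> G) :=
  (forall v p, B p -> S v p -> \forall q \near p, B q -> h v q = h v p) /\
  (forall v w p, B p -> S v p -> S w p -> h w p = h v p + c v w).

Definition trivial_over (B : set plane) := exists h, is_section B h.

Lemma trivial_small v (B : set plane) :
  B `<=` D -> B `<=` S v -> trivial_over B.
Proof.
move=> BD BS; exists (fun w _ => c v w); split.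
  by move=> w p _ _; near=> q.
move=> u w p Bp Su Sw; apply: (c_cocycle (BD _ Bp)) => //; exact: BS.
Unshelve. all: by end_near. Qed.

(** On a connected overlap two sections differ by an element of [G], which can
    be added to one of them. *)
Lemma trivial_glue (B1 B2 : set plane) :
  B1 `<=` D -> B2 `<=` D -> closed B1 -> closed B2 -> connected (B1 `&` B2) ->
  trivial_over B1 -> trivial_over B2 -> trivial_over (B1 `|` B2).
Proof.
move=> B1D B2D B1c B2c cB [h1 [loc1 tr1]] [h2 [loc2 tr2]].
have [d Hd] : exists d : G, forall v p, B1 p -> B2 p -> S v p -> h1 v p = h2 v p + d.
  have [[p0 [B1p0 B2p0]]|nB] := pselect (exists p, (B1 `&` B2) p); last first.
    exists 0 => v p B1p B2p; exfalso; apply: nB; by exists p.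
  have [f Hf] : exists f : plane -> V, forall p, D p -> S (f p) p.
    have [v0 _] := S_cover (B1D _ B1p0).
    have /choice [f Hf] : forall p, exists v, D p -> S v p.
      move=> p; have [Dp|nDp] := pselect (D p); last by exists v0.
      by have [v Sv] := S_cover Dp; exists v.
    by exists f.
  pose g p := h1 (f p) p - h2 (f p) p.
  have gE v p : B1 p -> B2 p -> S v p -> h1 v p = h2 v p + g p.
    move=> B1p B2p Sv; have Sf := Hf _ (B1D _ B1p).
    rewrite /g (tr1 v (f p) p) // (tr2 v (f p) p) //.
    by rewrite opprD addrACA subrr addr0 subrKC.
  exists (g p0) => v p B1p B2p Sv; rewrite (gE v) //; congr (_ + _).
  apply: (locally_constant_connected cB) => //.
  move=> q [B1q B2q]; have Sf := Hf _ (B1D _ B1q).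
  near=> r => -[B1r B2r].
  have Sr : S (f q) r.
    by have := B1D _ B1r; near: r; apply: S_open => //; exact: B1D.
  have e1 : h1 (f q) r = h1 (f q) q by move: B1r; near: r; exact: loc1.
  have e2 : h2 (f q) r = h2 (f q) q by move: B2r; near: r; exact: loc2.
  have := gE _ _ B1r B2r Sr.
  by rewrite e1 e2 (gE _ _ B1q B2q Sf) => /addrI.
exists (fun v q => if `[< B1 q >] then h1 v q else h2 v q + d); split.
  move=> v p Bp Sv.
  have E1 : \forall q \near p, B1 p -> B1 q -> h1 v q = h1 v p.
    have [B1p|nB1] := pselect (B1 p); last by near=> q => /nB1.
    by apply: filterS (loc1 _ _ B1p Sv) => q H _.
  have E2 : \forall q \near p, B2 p -> B2 q -> h2 v q = h2 v p.
    have [B2p|nB2] := pselect (B2 p); last by near=> q => /nB2.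
    by apply: filterS (loc2 _ _ B2p Sv) => q H _.
  have N B : closed B -> \forall q \near p, ~ B p -> ~ B q.
    move=> cB'; have [Bp'|nB] := pselect (B p); first by near=> q => /(_ Bp').
    have : \forall q \near p, (~` B) q.
      by apply: open_nbhs_nbhs; split => //; exact: closed_openC.
    by apply: filterS => q H _.
  near=> q => Bq.
  have e1 := near E1 q; have e2 := near E2 q.
  have n1 := near (N _ B1c) q; have n2 := near (N _ B2c) q.
  case: asboolP => B1q; case: asboolP => B1p.
  + by apply: e1.
  + by case: n1.
  + have B2q : B2 q by case: Bq.
    have B2p : B2 p by apply: contrapT => /n2; apply.
    by rewrite e2 // -Hd.
  + have B2q : B2 q by case: Bq.
    by rewrite e2 //; case: Bp.
move=> v w p Bp Sv Sw; case: asboolP => B1p; first exact: tr1.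
by rewrite (tr2 v w p) //; [rewrite addrAC|case: Bp].
Unshelve. all: by end_near. Qed.

Lemma trivial_local p : closed D ->
  exists2 e, 0 < e & forall B : set plane, B `<=` D -> B `<=` ball p e -> trivial_over B.
Proof.
move=> cD; have [Dp|nD] := pselect (D p).
  have [v Sv] := S_cover Dp.
  have /nbhs_ballP[e e0 He] := S_open Dp Sv.
  exists e => // B BD Be; apply: (@trivial_small v) => // q Bq.
  by apply: He; [exact: Be|exact: BD].
have : \forall q \near p, (~` D) q.
  by apply: open_nbhs_nbhs; split => //; exact: closed_openC.
move=> /nbhs_ballP[e e0 He]; exists e => // B BD Be.
exists (fun _ _ => 0); split => [v q Bq|v w q Bq]; by case: (He q (Be q Bq)); exact: BD.
Qed.

(** Subdivide a rectangle containing [D] into small ones, and glue the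
    sections along vertical, then horizontal segments. *)
Lemma trivial_convex (a b : R) : closed D -> is_convex D ->
  D `<=` rect a b a b -> trivial_over D.
Proof.
move=> cD convD DQ.
have [ba|ab] := ltP b a.
  exists (fun _ _ => 0); split => [v q /DQ []|v w q /DQ []] *; exfalso; lra.
pose T s t u v := trivial_over (D `&` rect s t u v).
have Tclosed s t u v : closed (D `&` rect s t u v).
  by apply: closedI => //; exact: rect_closed.
have Tconn s t u v : connected (D `&` rect s t u v).
  apply: convex_connected => p q [Dp rp] [Dq rq] x xs.
  by split; [exact: convD Dp Dq _ xs|exact: rect_convex rp rq _ xs].
have Tx s t w u v : s <= t -> t <= w -> T s t u v -> T t w u v -> T s w u v.
  move=> st tw T1 T2; rewrite /T.
  have -> : D `&` rect s w u v = (D `&` rect s t u v) `|` (D `&` rect t w u v).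
    rewrite -setIUr; congr (_ `&` _); apply/seteqP; split => x.
      by case=> ? ? ? ?; have [?|/ltW ?] := leP (x 0 0) t; [left|right].
    by case=> -[? ? ? ?]; split => //; lra.
  apply: trivial_glue => //; try exact: subIsetl.
  rewrite setIACA setIid.
  have -> : rect s t u v `&` rect t w u v = rect t t u v.
    apply/seteqP; split => x; first by case=> -[? ? ? ?] [? ? ? ?]; split.
    by case=> ? ? ? ?; split; split => //; lra.
  exact: Tconn.
have Ty s t u v w : u <= v -> v <= w -> T s t u v -> T s t v w -> T s t u w.
  move=> uv vw T1 T2; rewrite /T.
  have -> : D `&` rect s t u w = (D `&` rect s t u v) `|` (D `&` rect s t v w).
    rewrite -setIUr; congr (_ `&` _); apply/seteqP; split => x.
      by case=> ? ? ? ?; have [?|/ltW ?] := leP (x 0 1) v; [left|right].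
    by case=> -[? ? ? ?]; split => //; lra.
  apply: trivial_glue => //; try exact: subIsetl.
  rewrite setIACA setIid.
  have -> : rect s t u v `&` rect s t v w = rect s t v v.
    apply/seteqP; split => x; first by case=> -[? ? ? ?] [? ? ? ?]; split.
    by case=> ? ? ? ?; split; split => //; lra.
  exact: Tconn.
suff : T a b a b by rewrite /T setIidl.
apply: (@interval_subdivision _ (T a b)) => //; last first.
  by move=> s t u st tu; exact: Ty.
move=> y _.
suff [e e0 He] : exists2 e, 0 < e &
    forall u v, u <= v -> y - e < u -> v < y + e -> T a b u v by exists e.
apply: (@interval_subdivision _ (fun s t => exists2 e, 0 < e &
    forall u v, u <= v -> y - e < u -> v < y + e -> T s t u v)) => //; last first.
  move=> s t u st tu [e1 e10 H1] [e2 e20 H2]; exists (Num.min e1 e2).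
    by rewrite lt_min e10.
  move=> v w vw; rewrite ltrBlDr -ltrBlDl lt_min => /andP[? ?].
  rewrite -ltrBlDl lt_min => /andP[? ?].
  by apply: (@Tx _ t) => //; [apply: H1|apply: H2] => //; lra.
move=> x _.
pose p : plane := \row_i (if i == 0 then x else y).
have [e e0 He] := trivial_local p cD.
exists e => // s t st xs tx; exists e => // u v uv yu vy.
apply: He; first exact: subIsetl.
move=> q [_ [q0 q0' q1 q1']]; rewrite /ball /= /mx_ball; split => // i j.
rewrite (ord1 i) /ball /= !mxE ltr_distlC.
by case: (ord2P j) => -> /=; apply/andP; split; lra.
Qed.

End Cocycle.

(** * Simplices of the plane and barycentric coordinates *)

Section Hulls.
Variable R : realType.
Notation plane := 'rV[R]_2.
Implicit Types (a b c x y v : plane) (s t u r e : simplex R).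

Lemma hull_sub u s : (u `<=` s)%fset -> hull u `<=` hull s.
Proof.
move=> us x [c [c0 c1 ->]]; exists (fun v => if v \in u then c v else 0); split.
- by move=> v _; case: ifP => // /c0.
- rewrite -c1 -(big_fset_incl _ us) /=.
    by apply: eq_big_seq => v ->.
  by move=> v _ /negbTE ->.
- rewrite -(big_fset_incl _ us) /=.
    by apply: eq_big_seq => v ->.
  by move=> v _ /negbTE ->; rewrite scale0r.
Qed.

Lemma coord_unique s (c d : plane -> R) : affinely_independent s ->
  \sum_(v <- s) c v = 1 -> \sum_(v <- s) d v = 1 ->
  \sum_(v <- s) c v *: v = \sum_(v <- s) d v *: v ->
  forall v, v \in s -> c v = d v.
Proof.
move=> sI c1 d1 cd v vs; apply/eqP; rewrite -subr_eq0; apply/eqP.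
apply: (sI (fun v => c v - d v)) => //.
  by rewrite sumrB c1 d1 subrr.
under eq_bigr do rewrite scalerBl.
by rewrite sumrB cd subrr.
Qed.

Lemma hull_vertex s v : v \in s -> hull s v.
Proof.
move=> vs; apply: (@hull_sub [fset v]%fset); first by rewrite fsub1set.
by exists (fun=> 1); split; rewrite ?big_seq_fset1 ?scale1r // => ? _; exact: ler01.
Qed.

Lemma hull1 v x : hull [fset v]%fset x -> x = v.
Proof. by case=> c [_]; rewrite !big_seq_fset1 => -> ->; rewrite scale1r. Qed.

Lemma sum_fset2 (A : zmodType) (F : plane -> A) a b : a != b ->
  \sum_(v <- [fset a; b]%fset) F v = F a + F b.
Proof. by move=> ab; rewrite big_fsetU1 ?inE ?big_seq_fset1. Qed.

Lemma sum_fset3 (A : zmodType) (F : plane -> A) a b c :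
  a != b -> a != c -> b != c ->
  \sum_(v <- [fset a; b; c]%fset) F v = F a + F b + F c.
Proof.
move=> ab ac bc; rewrite fsetUC big_fsetU1 ?sum_fset2 //=; first by rewrite addrC.
by rewrite !inE negb_or eq_sym ac eq_sym bc.
Qed.

Lemma cardfs3 a b c : a != b -> a != c -> b != c ->
  #|` [fset a; b; c]%fset| = 3%N.
Proof.
move=> ab ac bc; rewrite fsetUC cardfsU1 cardfs2 ab !inE negb_or.
by rewrite eq_sym ac eq_sym bc.
Qed.

Lemma hull2 a b x : a != b -> hull [fset a; b]%fset x <-> seg a b x.
Proof.
move=> ab; split.
  case=> c [c0]; rewrite !sum_fset2 // => c1 ->.
  have ca := c0 a; have cb := c0 b; rewrite !inE !eqxx orbT in ca cb.
  exists (c b); first by rewrite /= in_itv /=; have := ca isT; have := cb isT; lra.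
  have -> : c a = 1 - c b by rewrite -c1 addrK.
  by apply/rowP => i; rewrite !mxE; ring.
case=> t; rewrite /= in_itv /= => /andP[t0 t1] <-.
exists (fun v => if v == a then 1 - t else t); split.
- by move=> v _; case: ifP => _ //; lra.
- by rewrite sum_fset2 // eqxx eq_sym (negbTE ab) subrK.
- rewrite sum_fset2 // eqxx eq_sym (negbTE ab).
  by apply/rowP => i; rewrite !mxE; ring.
Qed.

Lemma hull3P a b c x : a != b -> a != c -> b != c ->
  hull [fset a; b; c]%fset x <->
  exists k l m, [/\ 0 <= k, 0 <= l, 0 <= m, k + l + m = 1
    & x = k *: a + l *: b + m *: c].
Proof.
move=> ab ac bc; split.
  case=> k [k0]; rewrite !sum_fset3 // => k1 ->.
  exists (k a), (k b), (k c).
  by split=> //; apply: k0; rewrite !inE eqxx ?orbT.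
case=> k [l [m [k0 l0 m0 klm ->]]].
exists (fun v => if v == a then k else if v == b then l else m).
have E := (eqxx, eq_sym b a, eq_sym c a, eq_sym c b, negbTE ab, negbTE ac, negbTE bc).
by split; rewrite ?sum_fset3 ?E // => v _; do !case: ifP.
Qed.

(** Twice the signed area of the triangle [a b y]. *)
Definition side a b y : R :=
  (b 0 0 - a 0 0) * (y 0 1 - a 0 1) - (b 0 1 - a 0 1) * (y 0 0 - a 0 0).

Lemma side_cts a b : continuous (side a b).
Proof.
have -> : side a b = fun y => - (b 0 1 - a 0 1) * y 0 0 + (b 0 0 - a 0 0) * y 0 1
    + ((b 0 1 - a 0 1) * a 0 0 - (b 0 0 - a 0 0) * a 0 1).
  by apply/funext => y; rewrite /side; ring.
exact: affine_cts.
Qed.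

Lemma side_seg a b x : seg a b x -> side a b x = 0.
Proof. by case=> t _ <-; rewrite /side !line_coord; ring. Qed.

Lemma side_comb a b x y (k l m : R) c : k + l + m = 1 ->
  side a b (k *: x + l *: y + m *: c) = k * side a b x + l * side a b y + m * side a b c.
Proof.
move=> /(canRL (addrK _)) /(canRL (addrK _)) ->.
by rewrite /side !mxE; ring.
Qed.

Lemma side_aab a b : side a b a = 0.
Proof. by rewrite /side; ring. Qed.

Lemma side_abb a b : side a b b = 0.
Proof. by rewrite /side; ring. Qed.

Lemma side_rot a b c : side b c a = side a b c.
Proof. by rewrite /side; ring. Qed.

Lemma barycentric a b c y : side a b c != 0 ->
  let D := side a b c in
  y = (side b c y / D) *: a + (side c a y / D) *: b + (side a b y / D) *: c /\
  side b c y / D + side c a y / D + side a b y / D = 1.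
Proof.
move=> D0 /=; split; last first.
  by rewrite -!mulrDl; apply: (canLR (mulfK D0)); rewrite mul1r /side; ring.
have F (A B C x : R) : side a b c * x = A + B + C ->
    x = A / side a b c + B / side a b c + C / side a b c.
  by move=> E; rewrite -!mulrDl -E mulrC mulKf.
apply: plane_eq; rewrite !mxE.
  rewrite ![_ / _ * _]mulrAC; apply: F; rewrite /side; ring.
rewrite ![_ / _ * _]mulrAC; apply: F; rewrite /side; ring.
Qed.

Lemma hull_tri a b c y : side a b c != 0 -> a != b -> a != c -> b != c ->
  hull [fset a; b; c]%fset y <->
  [/\ 0 <= side b c y / side a b c, 0 <= side c a y / side a b c
    & 0 <= side a b y / side a b c].
Proof.
move=> D0 ab ac bc; split.
  move/(hull3P _ ab ac bc) => [k [l [m [k0 l0 m0 klm ->]]]].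
  rewrite !side_comb // !(side_aab, side_abb) (side_rot a b c).
  rewrite (side_rot b c a) (side_rot a b c).
  by rewrite !(mulr0, addr0, add0r) !mulfK.
move=> [h1 h2 h3]; apply/hull3P => //.
by have [E1 E2] := barycentric y D0; do 3!eexists; split; last exact: E1.
Qed.

(** If the area vanishes, each coordinate of the two edge vectors at [a] gives
    the coefficients of an affine relation between [a], [b] and [c]. *)
Lemma aff_indep_side a b c : a != b -> a != c -> b != c ->
  affinely_independent [fset a; b; c]%fset -> side a b c != 0.
Proof.
move=> ab ac bc I; apply/eqP => D0.
have H i : b 0 i = a 0 i.
  pose k v := if v == a then (c 0 i - a 0 i) - (b 0 i - a 0 i)
    else if v == b then - (c 0 i - a 0 i) else b 0 i - a 0 i.
  have E := (eqxx, eq_sym b a, eq_sym c a, eq_sym c b, negbTE ab, negbTE ac, negbTE bc).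
  apply/eqP; rewrite -subr_eq0; apply/eqP.
  have -> : b 0 i - a 0 i = k c by rewrite /k !E.
  apply: I; last by rewrite !inE eqxx orbT.
    by rewrite sum_fset3 // /k !E; ring.
  rewrite sum_fset3 // /k !E.
  move: D0; rewrite /side => D0.
  case: (ord2P i) => ->.
    by apply: plane_eq; rewrite !mxE; [ring|rewrite -[RHS]D0; ring].
  apply: plane_eq; rewrite !mxE; last ring.
  by apply: oppr_inj; rewrite oppr0 -[RHS]D0; ring.
by case/eqP: ab; apply: plane_eq; rewrite H.
Qed.

Lemma seg_closed a b : closed (seg a b).
Proof.
apply: compact_closed; first exact: norm_hausdorff.
apply: continuous_compact; last exact: segment_compact.
exact/continuous_subspaceT/line_continuous.
Qed.

Lemma near_line (P : set plane) x (u : plane) : (\forall y \near x, P y) ->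
  exists2 t : R, 0 < t < 1 & P (x + t *: u).
Proof.
move=> Px; have : \forall t \near (0 : R), P (x + t *: u).
  have := @line_continuous R x u 0; apply.
  by rewrite scale0r addr0; exact: Px.
move/nbhs_ballP => [e /= e0 He].
have me : 0 < Num.min e 1 by rewrite lt_min e0 ltr01.
have [t /andP[t0]] := avoid_finite [::] me.
rewrite lt_min => /andP[te t1] _.
exists t; first by rewrite t0.
by apply: He; rewrite /ball /= sub0r normrN gtr0_norm.
Qed.

Lemma card3_split a b t : a != b -> a \in t -> b \in t -> #|` t| = 3%N ->
  exists c, [/\ c != a, c != b & t = [fset a; b; c]%fset].
Proof.
move=> ab at_ bt t3.
have sub : ([fset a; b] `<=` t)%fset by rewrite fsubUset !fsub1set at_ bt.
have /eqP/cardfs1P[c cE] : #|` (t `\` [fset a; b])%fset| = 1%N.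
  by rewrite cardfsDS // cardfs2 ab t3.
have : c \in (t `\` [fset a; b])%fset by rewrite cE inE.
rewrite !inE negb_or => /andP[/andP[ca cb] ct].
exists c; split => //; apply/eqP; rewrite eq_sym eqEfcard.
rewrite !fsubUset !fsub1set at_ bt ct /= t3 cardfs3 //.
- by rewrite eq_sym.
- by rewrite eq_sym.
Qed.

Lemma triangle_at a t : #|` t| = 3%N -> a \in t ->
  exists b c, [/\ a != b, a != c, b != c & t = [fset a; b; c]%fset].
Proof.
move=> t3 at_.
have [b] : exists b, b \in (t `\ a)%fset.
  apply/fset0Pn; rewrite -cardfs_eq0; have := cardfsD1 a t.
  by rewrite at_ t3; case: #|` _|.
rewrite !inE => /andP[ba bt]; rewrite eq_sym in ba.
have [c [ca cb ->]] := card3_split ba at_ bt t3.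
by exists b, c; rewrite ba eq_sym ca eq_sym cb.
Qed.

Lemma edge_pair e : #|` e| = 2%N -> exists a b, a != b /\ e = [fset a; b]%fset :> simplex R.
Proof.
move=> e2; have [a ae] : exists a, a \in e by apply/fset0Pn; rewrite -cardfs_eq0 e2.
have /eqP/cardfs1P[b bE] : #|` (e `\ a)%fset| = 1%N.
  by have := cardfsD1 a e; rewrite ae e2 add1n => -[].
have : b \in (e `\ a)%fset by rewrite bE inE.
rewrite !inE => /andP[ba bs]; exists a, b; rewrite eq_sym ba; split => //.
by rewrite -bE fsetD1K.
Qed.

Lemma edge_at a e : #|` e| = 2%N -> a \in e ->
  exists2 b, a != b & e = [fset a; b]%fset :> simplex R.
Proof.
move=> e2 ae; have [x [y [xy eE]]] := edge_pair e2.
move: ae; rewrite eE !inE => /orP[/eqP ->|/eqP ->]; first by exists y.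
by exists x; [rewrite eq_sym|rewrite fsetUC].
Qed.

Lemma edge_of_triangle a b c e : #|` e| = 2%N -> a \in e ->
  (e `<=` [fset a; b; c])%fset -> e = [fset a; b]%fset \/ e = [fset a; c]%fset :> simplex R.
Proof.
move=> e2 ae; have [x ax ->] := edge_at e2 ae => /fsubsetP/(_ x).
rewrite !inE eqxx orbT eq_sym (negbTE ax) => /(_ isT) /orP[/eqP ->|/eqP ->]; by [left|right].
Qed.

End Hulls.

(** * Local structure of a plane simplicial complex *)

Section Complex.
Variables (R : realType) (K : {fset (simplex R)}).
Hypothesis K_complex : is_complex K.
Notation plane := 'rV[R]_2.
Implicit Types (a b c x y v : plane) (s t u r e : simplex R).

Lemma K_neq0 s : s \in K -> s != fset0.
Proof. by case: K_complex => H _ _ /H []. Qed.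

Lemma K_card s : s \in K -> (#|` s| <= 3)%N.
Proof. by case: K_complex => H _ _ /H []. Qed.

Lemma K_indep s : s \in K -> affinely_independent s.
Proof. by case: K_complex => H _ _ /H []. Qed.

Lemma K_face s t : s \in K -> t != fset0 -> (t `<=` s)%fset -> t \in K.
Proof. by case: K_complex => _ H _; apply: H. Qed.

Lemma K_face1 s v : s \in K -> v \in s -> [fset v]%fset \in K.
Proof.
move=> sK vs; apply: (K_face sK); last by rewrite fsub1set.
by apply/fset0Pn; exists v; rewrite inE.
Qed.

Lemma K_face2 s a b : s \in K -> a \in s -> b \in s -> [fset a; b]%fset \in K.
Proof.
move=> sK as_ bs; apply: (K_face sK); last by rewrite fsubUset !fsub1set as_ bs.
by apply/fset0Pn; exists a; rewrite !inE eqxx.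
Qed.

Lemma K_meet s t x : s \in K -> t \in K -> hull s x -> hull t x ->
  exists u, [/\ u \in K, (u `<=` s)%fset, (u `<=` t)%fset & hull u x].
Proof.
move=> sK tK sx tx; case: K_complex => _ _ /(_ s t sK tK) [E|[u [u0 us ut E]]].
  by have : (hull s `&` hull t) x by []; rewrite E.
exists u; split => //; first exact: (K_face sK).
by rewrite -E.
Qed.

(** [s] is the simplex of [K] that has [x] in its relative interior. *)
Definition carrier s x :=
  [/\ s \in K, hull s x & forall t, t \in K -> hull t x -> (s `<=` t)%fset].

(** A simplex that contains [x] and is not contained in some other one with
    this property can be replaced by the common face given by [K_meet]. *)
Lemma carrier_exists x : body K x -> exists s, carrier s x.
Proof.
move=> [s0 s0K s0x].
have [n] := ubnP #|` s0|; elim: n s0 s0K s0x => // n IH s sK sx sn.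
have [H|] := pselect (forall t, t \in K -> hull t x -> (s `<=` t)%fset).
  by exists s.
move=> /existsNP[t /not_implyP[tK /not_implyP[tx nst]]].
have [u [uK us ut ux]] := K_meet sK tK sx tx.
apply: (IH u) => //; rewrite -ltnS; apply: leq_trans sn; rewrite ltnS.
apply: fproper_ltn_card; rewrite fproperEneq us andbT.
by apply/eqP => E; apply: nst; rewrite -E.
Qed.

Lemma carrier_body s x : carrier s x -> body K x.
Proof. by case=> sK sx _; exists s. Qed.

(** A vertex of coordinate 0 could be removed from the carrier. *)
Lemma carrier_pos s x (c : plane -> R) : carrier s x ->
  (forall v, v \in s -> 0 <= c v) -> \sum_(v <- s) c v = 1 ->
  x = \sum_(v <- s) c v *: v -> forall v, v \in s -> 0 < c v.
Proof.
move=> [sK sx sm] c0 c1 xE v vs.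
rewrite lt_neqAle c0 // andbT; apply/negP => /eqP cv.
suff : (s `<=` s `\ v)%fset by move/fsubsetP/(_ v vs); rewrite !inE eqxx.
have sv : (s `\ v `<=` s)%fset by exact: fsubD1set.
have E (A : zmodType) (F : plane -> A) : F v = 0 ->
    \sum_(w <- (s `\ v)%fset) F w = \sum_(w <- s) F w.
  move=> Fv; rewrite (big_fset_incl _ sv) // => w ws.
  by rewrite !inE ws andbT negbK => /eqP ->.
have h : hull (s `\ v)%fset x.
  exists c; split => [w| |].
  - by rewrite !inE => /andP[_ /c0].
  - by rewrite E.
  - by rewrite (E _ (fun w => c w *: w)) // -cv scale0r.
apply: sm => //; apply: (K_face sK) => //.
apply/eqP => s0; case: h => d [_]; rewrite s0 big_seq_fset0 => /esym/eqP.
by rewrite oner_eq0.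
Qed.

(** The face in which a simplex [t] containing [x] meets [s] must have all
    vertices of [s], because barycentric coordinates on [s] are unique. *)
Lemma pos_carrier s x (c : plane -> R) : s \in K ->
  (forall v, v \in s -> 0 < c v) -> \sum_(v <- s) c v = 1 ->
  x = \sum_(v <- s) c v *: v -> carrier s x.
Proof.
move=> sK c0 c1 xE.
have sx : hull s x by exists c; split => // v /c0/ltW.
split => // t tK tx; have [u [uK us ut [d [d0 d1 xd]]]] := K_meet sK tK sx tx.
apply: fsubset_trans ut; apply/fsubsetP => v vs.
apply: contraT => vu; pose d' w := if w \in u then d w else 0.
have : c v = d' v.
  apply: (@coord_unique _ s) vs => //; first exact: K_indep.
  - rewrite -d1 -(big_fset_incl _ us) /=; first by apply: eq_big_seq => w; rewrite /d' => ->.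
    by move=> w _ wu; rewrite /d' (negbTE wu).
  - rewrite -xE xd -(big_fset_incl _ us) /=; first by apply: eq_big_seq => w; rewrite /d' => ->.
    by move=> w _ wu; rewrite /d' (negbTE wu) scale0r.
by rewrite /d' (negbTE vu) => cv; have := c0 v vs; rewrite cv ltxx.
Qed.

Lemma carrier_edge a b x : a != b -> [fset a; b]%fset \in K ->
  carrier [fset a; b]%fset x <-> exists2 t : R, 0 < t < 1 & x = a + t *: (b - a).
Proof.
move=> ab eK; split.
  move=> cx; have [_ [c [c0 c1 xE]] _] := cx.
  have cp := carrier_pos cx c0 c1 xE.
  have ca := cp a; have cb := cp b; rewrite !inE !eqxx orbT in ca cb.
  rewrite !sum_fset2 // in c1 xE.
  exists (c b); first by have := ca isT; have := cb isT; lra.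
  have caE : c a = 1 - c b by rewrite -c1 addrK.
  by rewrite xE caE; apply/rowP => i; rewrite !mxE; ring.
move=> [t /andP[t0 t1] xE]; apply: (@pos_carrier _ _ (fun v => if v == a then 1 - t else t)) => //.
- by move=> v _; case: ifP => _ //; lra.
- by rewrite sum_fset2 // eqxx eq_sym (negbTE ab) subrK.
- rewrite sum_fset2 // eqxx eq_sym (negbTE ab) xE.
  by apply/rowP => i; rewrite !mxE; ring.
Qed.

Lemma carrier_vertex v : [fset v]%fset \in K -> carrier [fset v]%fset v.
Proof.
move=> vK; apply: (@pos_carrier _ _ (fun=> 1)) => //.
  by rewrite big_seq_fset1.
by rewrite big_seq_fset1 scale1r.
Qed.

Lemma carrier_point s : s \in K -> exists x, carrier s x.
Proof.
move=> sK; pose n : R := #|` s|%:R.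
have n0 : n != 0 by rewrite pnatr_eq0 cardfs_eq0 K_neq0.
exists (\sum_(v <- s) n^-1 *: v); apply: (@pos_carrier _ _ (fun=> n^-1)) => //.
  by move=> v _; rewrite invr_gt0 lt_neqAle eq_sym n0 ler0n.
rewrite big_const_seq count_predT iter_addr_0 -[size _]/(#|` s|) -mulr_natr.
by rewrite mulVf.
Qed.

Lemma cards_cases s : s \in K ->
  [\/ exists v, s = [fset v]%fset, exists a b, a != b /\ s = [fset a; b]%fset | #|` s| = 3%N].
Proof.
move=> sK; have := K_card sK; have := K_neq0 sK.
rewrite -cardfs_eq0; case E : #|` s| => [|[|[|[|//]]]] // _ _; last exact: Or33.
- by have /eqP/cardfs1P[v ->] := E; apply: Or31; exists v.
- by apply: Or32; exact: edge_pair.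
Qed.

Lemma tri_side a b c : [fset a; b; c]%fset \in K -> a != b -> a != c -> b != c ->
  side a b c != 0.
Proof. by move=> tK ab ac bc; apply: aff_indep_side => //; exact: K_indep. Qed.

Lemma hull_closed s : s \in K -> closed (hull s).
Proof.
move=> sK; have [[v ->]|[a [b [ab ->]]]|s3] := cards_cases sK.
- have -> : hull [fset v]%fset = [set v].
    apply/seteqP; split => x /=; first exact: hull1.
    by move=> ->; apply: hull_vertex; rewrite inE.
  apply: compact_closed; [exact: norm_hausdorff|exact: compact_set1].
- have -> : hull [fset a; b]%fset = seg a b; last exact: seg_closed.
  by apply/seteqP; split => x /hull2; apply.
have [a as_] : exists a, a \in s by apply/fset0Pn; exact: K_neq0.
have [b [c [ab ac bc sE]]] := triangle_at s3 as_.
rewrite sE in sK *.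
have D0 := tri_side sK ab ac bc.
have -> : hull [fset a; b; c]%fset =
    [set y | 0 <= side b c y / side a b c] `&`
    ([set y | 0 <= side c a y / side a b c] `&` [set y | 0 <= side a b y / side a b c]).
  apply/seteqP; split => x /=; first by move/hull_tri => [].
  by move=> [? [? ?]]; apply/hull_tri.
have cl p q : closed [set y | 0 <= side p q y / side a b c].
  apply: (@closed_comp _ _ (fun y => side p q y / side a b c) [set y | 0 <= y]); last exact: closed_ge.
  by move=> y _; exact (cvgM (@side_cts R p q y) (cvg_cst _)).
by apply: closedI => //; apply: closedI.
Qed.

(** There are finitely many hulls, and they are closed. *)
Lemma near_hull x : \forall y \near x, forall s, s \in K -> hull s y -> hull s x.
Proof.
have H (s : K) : \forall y \near x, hull (val s) y -> hull (val s) x.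
  have [sx|nsx] := pselect (hull (val s) x); first by near=> y.
  have : \forall y \near x, (~` hull (val s)) y.
    apply: open_nbhs_nbhs; split => //; apply: closed_openC.
    exact/hull_closed/valP.
  by apply: filterS => y ny /ny.
have := filter_forall (nbhs_filter x) H.
by apply: filterS => y Hy s sK; apply: (Hy [` sK]%fset).
Unshelve. all: by end_near. Qed.

Lemma near_carrier s x : carrier s x ->
  \forall y \near x, forall t, t \in K -> hull t y -> (s `<=` t)%fset.
Proof.
by move=> [_ _ sm]; apply: filterS (near_hull x) => y Hy t tK ty; apply/sm/Hy.
Qed.

(** Two barycentric coordinates that are positive at [x] remain so nearby, so
    that the third one decides. *)
Lemma near_triangle a b c x : [fset a; b; c]%fset \in K ->
  a != b -> a != c -> b != c ->
  0 < side b c x / side a b c -> 0 < side c a x / side a b c ->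
  \forall y \near x, 0 <= side a b y / side a b c -> hull [fset a; b; c]%fset y.
Proof.
move=> tK ab ac bc h1 h2; have D0 := tri_side tK ab ac bc.
have cts p q : continuous (fun y => side p q y / side a b c).
  by move=> y; exact (cvgM (@side_cts R p q y) (cvg_cst _)).
have H1 := near_fun_gt (cts b c) h1; have H2 := near_fun_gt (cts c a) h2.
near=> y => h3; apply/hull_tri => //; split => //; apply: ltW.
  by near: y.
by near: y.
Unshelve. all: by end_near. Qed.

Lemma near_half_triangle a b c x : [fset a; b; c]%fset \in K ->
  a != b -> a != c -> b != c -> carrier [fset a; b]%fset x ->
  \forall y \near x, 0 <= side a b y / side a b c -> hull [fset a; b; c]%fset y.
Proof.
move=> tK ab ac bc cx; have D0 := tri_side tK ab ac bc.
have [eK _ _] := cx; have [t /andP[t0 t1] xE] := (carrier_edge _ ab eK).1 cx.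
apply: near_triangle => //.
  suff -> : side b c x / side a b c = 1 - t by rewrite subr_gt0.
  by apply: (canLR (mulfK D0)); rewrite xE /side !line_coord; ring.
suff -> : side c a x / side a b c = t by [].
by apply: (canLR (mulfK D0)); rewrite xE /side !line_coord; ring.
Qed.

Lemma triangle_interior t x : #|` t| = 3%N -> carrier t x -> interior (body K) x.
Proof.
move=> t3 cx; have [tK [k [k0 k1 xE]] _] := cx.
have kp := carrier_pos cx k0 k1 xE.
have [a at_] : exists a, a \in t by apply/fset0Pn; exact: K_neq0.
have [b [c [ab ac bc tE]]] := triangle_at t3 at_.
rewrite tE in tK kp k1 xE.
have D0 := tri_side tK ab ac bc.
rewrite !sum_fset3 // in k1 xE.
have E1 : side b c x / side a b c = k a.
  apply: (canLR (mulfK D0)).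
  by rewrite xE side_comb // side_aab side_abb side_rot !mulr0 !addr0.
have E2 : side c a x / side a b c = k b.
  apply: (canLR (mulfK D0)).
  by rewrite xE side_comb // side_aab side_abb -(side_rot c a b) !mulr0 addr0 add0r.
have E3 : side a b x / side a b c = k c.
  apply: (canLR (mulfK D0)).
  by rewrite xE side_comb // side_aab side_abb !mulr0 !add0r.
have kk v : v \in [fset a; b; c]%fset -> 0 < k v by exact: kp.
have := kk a; have := kk b; have := kk c; rewrite !inE !eqxx !orbT.
move=> /(_ isT) kc /(_ isT) kb /(_ isT) ka.
have cts : continuous (fun y => side a b y / side a b c).
  by move=> y; exact (cvgM (@side_cts R a b y) (cvg_cst _)).
have N1 : \forall y \near x, 0 <= side a b y / side a b c -> hull [fset a; b; c]%fset y.
  by apply: near_triangle; rewrite ?E1 ?E2.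
have N2 : \forall y \near x, 0 < side a b y / side a b c.
  by apply: (near_fun_gt cts); rewrite E3.
near=> y; exists [fset a; b; c]%fset => //.
by apply: (near N1 y) => //; apply: ltW; near: y.
Unshelve. all: by end_near. Qed.

End Complex.

(** * Interior and boundary simplices *)

Section InteriorEdges.
Variables (R : realType) (K : {fset (simplex R)}).
Hypothesis K_complex : is_complex K.
Notation plane := 'rV[R]_2.
Implicit Types (a b c d x y v : plane) (s t u r e : simplex R).

Lemma boundaryP s : s \in boundary K <-> s \in K /\ hull s `<=` frontier (body K).
Proof. by rewrite /boundary !inE /=; split=> [/andP[-> /asboolP]|[-> /asboolP ->]]. Qed.

Lemma body_hull s : s \in K -> hull s `<=` body K.
Proof. by move=> sK x sx; exists s. Qed.

Lemma not_boundary s : s \in K -> s \notin boundary K ->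
  exists2 x, hull s x & interior (body K) x.
Proof.
move=> sK /negP nb; apply: contrapT => H; apply: nb; apply/boundaryP.
split => // x sx; split; first exact/subset_closure/(body_hull sK).
by move=> ix; apply: H; exists x.
Qed.

Lemma interior_not_boundary s x : hull s x -> interior (body K) x ->
  s \notin boundary K.
Proof. by move=> sx ix; apply/negP => /boundaryP[_ /(_ x sx) []]. Qed.

Lemma boundary_face s t : s \in boundary K -> t \in K -> (t `<=` s)%fset ->
  t \in boundary K.
Proof.
move=> /boundaryP[_ sb] tK ts; apply/boundaryP; split => //.
exact: subset_trans (hull_sub ts) sb.
Qed.

Lemma triangle_not_boundary t : t \in K -> #|` t| = 3%N -> t \notin boundary K.
Proof.
move=> tK t3; have [x cx] := carrier_point K_complex tK.
by have [_ tx _] := cx; apply: (interior_not_boundary tx); apply: triangle_interior cx.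
Qed.

(** Move a point of the edge slightly towards the midpoint. *)
Lemma open_meets_open_edge a b (P : set plane) : a != b -> [fset a; b]%fset \in K ->
  open P -> (exists2 x, hull [fset a; b]%fset x & P x) ->
  exists2 x, carrier K [fset a; b]%fset x & P x.
Proof.
move=> ab eK oP [x /(hull2 _ ab) [t]]; rewrite /= in_itv /= => /andP[t0 t1] xE Px.
have [s /andP[s0 s1] Ps] := near_line ((2^-1 - t) *: (b - a)) (oP x Px).
exists (x + s *: ((2^-1 - t) *: (b - a))) => //.
apply/(carrier_edge K_complex _ ab eK); exists (t + s * (2^-1 - t)).
  by apply/andP; split; nra.
by rewrite -xE; apply/rowP => i; rewrite !mxE; ring.
Qed.

Lemma midpoint_carrier a b : a != b -> [fset a; b]%fset \in K ->
  carrier K [fset a; b]%fset (a + 2^-1 *: (b - a)).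
Proof.
move=> ab eK; apply/(carrier_edge K_complex _ ab eK); exists 2^-1 => //.
by apply/andP; split; lra.
Qed.

(** Two triangles on the same side of [a b] overlap near the midpoint of that
    edge, but may only meet along a common face. *)
Lemma same_side_eq a b c d : a != b -> a != c -> b != c -> a != d -> b != d ->
  [fset a; b; c]%fset \in K -> [fset a; b; d]%fset \in K ->
  0 < side a b c * side a b d -> c = d.
Proof.
move=> ab ac bc ad bd cK dK cd0.
have eK : [fset a; b]%fset \in K by apply: (K_face2 K_complex cK); rewrite !inE eqxx ?orbT.
pose m := a + 2^-1 *: (b - a).
have cm : carrier K [fset a; b]%fset m by exact: midpoint_carrier.
have N1 := near_half_triangle K_complex cK ab ac bc cm.
have N2 := near_half_triangle K_complex dK ab ad bd cm.
have [t /andP[t0 t1] [H1 H2]] := near_line (c - m) (filterI N1 N2).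
have Dc := tri_side K_complex cK ab ac bc; have Dd := tri_side K_complex dK ab ad bd.
have sE : side a b (m + t *: (c - m)) = t * side a b c.
  by rewrite /side !mxE; field.
set y := m + _ in H1 H2 sE.
have yc : hull [fset a; b; c]%fset y by apply: H1; rewrite sE mulfK // ltW.
have yd : hull [fset a; b; d]%fset y.
  apply: H2; rewrite sE -mulrA mulr_ge0 //; first exact: ltW.
  have -> : side a b c / side a b d = side a b c * side a b d / side a b d ^+ 2.
    by field.
  by rewrite divr_ge0 ?sqr_ge0 // ltW.
have [u [uK uc ud uy]] := K_meet K_complex cK dK yc yd.
apply: contrapT => /eqP cd.
have ue : (u `<=` [fset a; b])%fset.
  apply/fsubsetP => v vu; move/fsubsetP/(_ v vu): uc; move/fsubsetP/(_ v vu): ud.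
  rewrite !inE; case/orP => [->//|/eqP ->]; rewrite (eq_sym d c) (negbTE cd) orbF.
  by rewrite !(eq_sym d).
have := side_seg ((hull2 _ ab).1 (hull_sub ue uy)); rewrite sE => /eqP.
by rewrite mulf_eq0 (negbTE Dc) gt_eqF.
Qed.

Lemma opposite_sides_interior a b c d x : a != b -> a != c -> b != c ->
  a != d -> b != d ->
  [fset a; b; c]%fset \in K -> [fset a; b; d]%fset \in K ->
  side a b c * side a b d < 0 -> carrier K [fset a; b]%fset x ->
  interior (body K) x.
Proof.
move=> ab ac bc ad bd cK dK cd0 cx.
have N1 := near_half_triangle K_complex cK ab ac bc cx.
have N2 := near_half_triangle K_complex dK ab ad bd cx.
near=> y.
have H1 := near N1 y; have H2 := near N2 y.
have [hc|hc] := leP 0 (side a b y / side a b c).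
  by apply: (body_hull cK); apply: H1.
apply: (body_hull dK); apply: H2 => //.
have Dc := tri_side K_complex cK ab ac bc; have Dd := tri_side K_complex dK ab ad bd.
have -> : side a b y / side a b d =
    (side a b y / side a b c) * (side a b c * side a b d) / side a b d ^+ 2.
  by field; rewrite ?Dc ?Dd.
by rewrite divr_ge0 ?sqr_ge0 // mulr_le0 // ltW.
Unshelve. all: by end_near. Qed.

(** Points of the open edge lie in the interior of the body; moving off such a
    point to either side stays in the body, hence in a triangle on that side. *)
Lemma interior_edge_side a b (k : R) : a != b -> [fset a; b]%fset \in K ->
  [fset a; b]%fset \notin boundary K -> k != 0 ->
  exists c, [/\ a != c, b != c, [fset a; b; c]%fset \in K & 0 < k * side a b c].
Proof.
move=> ab eK eb k0.
have [x cx ix] := open_meets_open_edge ab eK (open_interior _) (not_boundary eK eb).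
have Nb : \forall y \near x, body K y by exact: ix.
pose J : plane := k *: \row_i (if i == 0 then - (b 0 1 - a 0 1) else b 0 0 - a 0 0).
have [t /andP[t0 t1] [[r rK ry] Hc]] :=
  near_line J (filterI Nb (near_carrier K_complex cx)).
have er := Hc r rK ry; set y := x + t *: J in ry.
have sx : side a b x = 0.
  by apply: side_seg; apply/hull2 => //; case: cx.
have sE : side a b y = t * k * ((b 0 0 - a 0 0) ^+ 2 + (b 0 1 - a 0 1) ^+ 2).
  by rewrite -[LHS]subr0 -[X in _ - X]sx /side /y !mxE /=; ring.
have N0 := sqdist_gt0 (elimN eqP ab).
have ks : 0 < k * side a b y.
  rewrite sE; have -> : forall N, k * (t * k * N) = t * k ^+ 2 * N by move=> N; ring.
  have kk : 0 < k ^+ 2 by rewrite exprn_even_gt0 // k0 orbT.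
  by apply: mulr_gt0 => //; exact: mulr_gt0.
have nre : r != [fset a; b]%fset.
  by apply/eqP => rE; move: ry; rewrite rE => /(hull2 _ ab) /side_seg h; rewrite h mulr0 ltxx in ks.
have r3 : #|` r| = 3%N.
  apply/eqP; rewrite eqn_leq (K_card K_complex rK) /=.
  have := fproper_ltn_card (_ : ([fset a; b] `<` r)%fset).
  by rewrite cardfs2 ab; apply; rewrite fproperEneq er eq_sym nre.
have [ar br] : a \in r /\ b \in r.
  by split; apply: (fsubsetP er); rewrite !inE eqxx ?orbT.
have [c [ca cb rE]] := card3_split ab ar br r3.
rewrite eq_sym in ca; rewrite eq_sym in cb.
rewrite rE in rK ry; exists c; split => //.
have D0 := tri_side K_complex rK ab ca cb.
have [_ _ h] := (hull_tri _ D0 ab ca cb).1 ry.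
move: ks; rewrite -(divfK D0 (side a b y)) mulrCA => ks.
have h' : 0 < side a b y / side a b c.
  rewrite lt_neqAle h andbT eq_sym; apply/eqP => h0.
  by rewrite h0 mul0r ltxx in ks.
by rewrite pmulr_rgt0 in ks.
Qed.

Lemma interior_edge_triangles a b : a != b -> [fset a; b]%fset \in K ->
  [fset a; b]%fset \notin boundary K ->
  exists c d, [/\ [fset a; b; c]%fset \in K /\ #|` [fset a; b; c]%fset| = 3%N,
     [fset a; b; d]%fset \in K /\ #|` [fset a; b; d]%fset| = 3%N,
     [fset a; b; c]%fset != [fset a; b; d]%fset,
     forall t, t \in K -> #|` t| = 3%N -> ([fset a; b] `<=` t)%fset ->
       t = [fset a; b; c]%fset \/ t = [fset a; b; d]%fset
   & forall x, carrier K [fset a; b]%fset x -> interior (body K) x].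
Proof.
move=> ab eK eb.
have [c [ac bc cK]] := interior_edge_side ab eK eb (oner_neq0 R).
rewrite mul1r => c0.
have n1 : (-1 : R) != 0 by rewrite oppr_eq0 oner_eq0.
have [d [ad bd dK]] := interior_edge_side ab eK eb n1.
rewrite mulN1r oppr_gt0 => d0.
exists c, d; split.
- by rewrite cardfs3.
- by rewrite cardfs3.
- apply/eqP => E; have : c \in [fset a; b; d]%fset by rewrite -E !inE eqxx orbT.
  rewrite !inE (eq_sym c a) (eq_sym c b) (negbTE ac) (negbTE bc) /= => /eqP cd.
  by rewrite cd in c0; have := lt_trans c0 d0; rewrite ltxx.
- move=> t tK t3 et.
  have [at_ bt] : a \in t /\ b \in t.
    by split; apply: (fsubsetP et); rewrite !inE eqxx ?orbT.
  have [f [fa fb tE]] := card3_split ab at_ bt t3.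
  rewrite eq_sym in fa; rewrite eq_sym in fb; rewrite tE in tK.
  have f0 := tri_side K_complex tK ab fa fb.
  have [f1|f1|f1] := ltgtP (side a b f) 0; last by rewrite f1 eqxx in f0.
  + right; rewrite tE; congr (_ `|` _)%fset; congr [fset _]%fset.
    by apply: (same_side_eq ab fa fb ad bd) => //; rewrite nmulr_rgt0.
  + left; rewrite tE; congr (_ `|` _)%fset; congr [fset _]%fset.
    by apply: (same_side_eq ab fa fb ac bc) => //; rewrite mulr_gt0.
- move=> x; apply: (opposite_sides_interior ab ac bc ad bd) => //.
  by rewrite pmulr_rlt0.
Qed.

Lemma boundary_edge_triangle a b t t' : a != b -> [fset a; b]%fset \in boundary K ->
  t \in K -> #|` t| = 3%N -> ([fset a; b] `<=` t)%fset ->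
  t' \in K -> #|` t'| = 3%N -> ([fset a; b] `<=` t')%fset -> t = t'.
Proof.
move=> ab eb tK t3 et tK' t3' et'.
have H s : ([fset a; b] `<=` s)%fset -> a \in s /\ b \in s.
  by move=> es; split; apply: (fsubsetP es); rewrite !inE eqxx ?orbT.
have [at_ bt] := H _ et; have [at' bt'] := H _ et'.
have [c [ca cb tE]] := card3_split ab at_ bt t3.
have [d [da db tE']] := card3_split ab at' bt' t3'.
rewrite eq_sym in ca; rewrite eq_sym in cb; rewrite eq_sym in da; rewrite eq_sym in db.
rewrite tE in tK *; rewrite tE' in tK' *.
have c0 := tri_side K_complex tK ab ca cb; have d0 := tri_side K_complex tK' ab da db.
have [eK _] := (boundaryP _).1 eb.
have [cd|cd|/eqP cd] := ltgtP (side a b c * side a b d) 0.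
- have cx := midpoint_carrier ab eK; have [_ mx _] := cx.
  have ix := opposite_sides_interior ab ca cb da db tK tK' cd cx.
  by have := interior_not_boundary mx ix; rewrite eb.
- by rewrite (same_side_eq ab ca cb da db tK tK' cd).
- by rewrite mulf_eq0 (negbTE c0) (negbTE d0) in cd.
Qed.

Lemma vertex_interior v : [fset v]%fset \in K -> [fset v]%fset \notin boundary K ->
  interior (body K) v.
Proof. by move=> vK vb; have [x /hull1 ->] := not_boundary vK vb. Qed.

(** A union of triangles that contains, with one triangle at the carrier [s]
    of [x], all of them, covers the body near [x]. *)
Lemma triangles_near (S : simplex R -> Prop) s t x :
  carrier K s x -> (1 < #|` s|)%N -> t \in K -> S t -> hull t x ->
  (forall r, r \in K -> #|` r| = 3%N -> (s `<=` r)%fset -> S r) ->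
  \forall y \near x, body K y -> exists r, [/\ r \in K, S r & hull r y].
Proof.
move=> cx s1 tK St tx HS.
have [sK _ sm] := cx.
apply: filterS (near_carrier K_complex cx) => y Hy [r rK ry].
have sr := Hy r rK ry.
have [E|nE] := eqVneq r s.
  by exists t; split => //; apply: (hull_sub (sm t tK tx)); rewrite -E.
exists r; split => //; apply: HS => //; apply/eqP.
rewrite eqn_leq (K_card K_complex rK) /=; apply: (leq_ltn_trans s1).
by apply: fproper_ltn_card; rewrite fproperEneq sr eq_sym nE.
Qed.

Lemma carrier_card1 s x : carrier K s x -> (#|` s| <= 1)%N ->
  s = [fset x]%fset.
Proof.
move=> [sK sx _]; have [[v sE]|[a [b [ab ->]]]|->] := cards_cases K_complex sK => //.
- by move: sx; rewrite sE => /hull1 ->.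
- by rewrite cardfs2 ab.
Qed.

End InteriorEdges.

(** * Stars of vertices *)

Section Stars.
Variables (R : realType) (K : {fset (simplex R)}).
Hypothesis K_complex : is_complex K.
Notation plane := 'rV[R]_2.
Implicit Types (a b c d x y v : plane) (s t u r e : simplex R).

Lemma card3_eq s t : s \in K -> t \in K -> #|` s| = 3%N -> (s `<=` t)%fset -> s = t.
Proof.
move=> sK tK s3 st; apply/eqP; rewrite eqEfcard st s3.
exact: (K_card K_complex tK).
Qed.

(** [Y] is a nonempty set of interior edges at [a] that contains, with one of
    the two edges at [a] of a triangle, also the other one. The triangles with
    an edge in [Y] cover a neighbourhood of each of their points near [a] other
    than [a] itself; the punctured ball around [a] is connected, so they cover
    it; in particular every edge at [a] lies in one of them. *)
Lemma star_transitive a (Y : simplex R -> Prop) : [fset a]%fset \in K ->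
  (exists e, Y e) ->
  (forall e, Y e -> [/\ e \in K, #|` e| = 2%N, a \in e & e \notin boundary K]) ->
  (forall t e e', t \in K -> #|` t| = 3%N -> (e `<=` t)%fset -> (e' `<=` t)%fset ->
     #|` e'| = 2%N -> a \in e' -> Y e -> Y e') ->
  [fset a]%fset \notin boundary K /\
  forall e, e \in K -> #|` e| = 2%N -> a \in e -> Y e.
Proof.
move=> aK [e0 Ye0] YK Yt.
have Na := near_carrier K_complex (carrier_vertex K_complex aK).
have [d d0 Hd] := (nbhs_ballP _ _).1 Na.
pose S t := #|` t| = 3%N /\ exists2 e, Y e & (e `<=` t)%fset.
pose B y := exists r, [/\ r \in K, S r & hull r y].
have edge_point e : e \in K -> #|` e| = 2%N -> a \in e ->
    exists2 x, carrier K e x & (ball a d `\` [set a]) x.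
  move=> eK e2 ae; have [b ab eE] := edge_at e2 ae.
  have [t /andP[t0 t1] Ht] := near_line (b - a) (nbhsx_ballx a d d0).
  exists (a + t *: (b - a)).
    by rewrite eE; apply/(carrier_edge K_complex _ ab); [rewrite -eE|exists t; rewrite ?t0].
  split => // /= /eqP; rewrite -subr_eq0 addrC addKr scaler_eq0 subr_eq0.
  by rewrite gt_eqF //= eq_sym (negbTE ab).
have SUB : ball a d `\` [set a] `<=` B.
  apply: connected_clopen; first exact: punctured_ball_connected.
  - have [e0K e02 ae0 e0b] := YK _ Ye0.
    have [x [_ ex _] Ux] := edge_point _ e0K e02 ae0; exists x => //.
    have [b ab eE] := edge_at e02 ae0.
    rewrite eE in e0K e0b.
    have [c [_ [[cK c3] _ _ _ _]]] := interior_edge_triangles K_complex ab e0K e0b.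
    have ec : (e0 `<=` [fset a; b; c])%fset by rewrite eE fsubsetUl.
    exists [fset a; b; c]%fset; split => //; last exact: hull_sub ec _ ex.
    by split => //; exists e0.
  - move=> x [xd /= xa] [t [tK [t3 [e Ye et]] tx]].
    have [s cs] := carrier_exists K_complex (body_hull tK tx).
    have [sK sx sm] := cs; have st := sm t tK tx.
    have as_ : a \in s by have := Hd x xd s sK sx; rewrite fsub1set.
    have s2 : (1 < #|` s|)%N.
      rewrite ltnNge; apply/negP => s1; apply: xa.
      have sE := carrier_card1 K_complex cs s1.
      by move: as_; rewrite sE inE => /eqP.
    have [SS ix] : (forall r, r \in K -> #|` r| = 3%N -> (s `<=` r)%fset -> S r) /\
        interior (body K) x.
      have [s3|s3] := eqVneq #|` s| 3%N.
        split; last exact: triangle_interior cs.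
        move=> r rK r3 sr; have <- := card3_eq sK rK s3 sr.
        by rewrite (card3_eq sK tK s3 st); split => //; exists e.
      have s2' : #|` s| = 2%N.
        by have := K_card K_complex sK; move: s2 s3; case: #|` s| => [|[|[|[|]]]].
      have Ys : Y s by apply: (Yt t e s).
      split; first by move=> r rK r3 sr; split => //; exists s.
      have [_ _ _ sb] := YK _ Ys.
      have [b ab sE] := edge_at s2' as_; rewrite sE in sK sb cs.
      have [c [c' [_ _ _ _]]] := interior_edge_triangles K_complex ab sK sb.
      exact.
    have St : S t by split => //; exists e.
    have N1 := triangles_near K_complex cs s2 tK St tx SS.
    have N2 : \forall y \near x, body K y by exact: ix.
    by near=> y => _; apply: (near N1 y) => //; near: y.
  - move=> x _ nB; apply: filterS (near_hull K_complex x) => y Hy _ [r [rK Sr ry]].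
    by apply: nB; exists r; split => //; exact: Hy.
split.
  apply: (@interior_not_boundary _ _ _ a); first by apply: hull_vertex; rewrite inE.
  apply/nbhs_ballP; exists d => // y yd.
  have [->|/eqP ya] := eqVneq y a.
    by apply: (body_hull aK); apply: hull_vertex; rewrite inE.
  have [r [rK _ ry]] := SUB y (conj yd ya).
  exact: (body_hull rK).
move=> e eK e2 ae; have [x [_ ex em] Ux] := edge_point e eK e2 ae.
have [r [rK [r3 [e' Ye' er']] rx]] := SUB x Ux.
by apply: (Yt r e' e) => //; exact: em.
Unshelve. all: by end_near. Qed.

(** Around an interior point the body extends in the direction of the first
    coordinate axis. *)
Lemma ascending_edge a : [fset a]%fset \in K -> [fset a]%fset \notin boundary K ->
  exists2 b, [fset a; b]%fset \in K & a 0 0 < b 0 0.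
Proof.
move=> aK ab; have ia : \forall y \near a, body K y by exact: vertex_interior.
pose u : plane := \row_i (i == 0)%:R.
have [k /andP[k0 _] [[r rK ry] Hr]] :=
  near_line u (filterI ia (near_carrier K_complex (carrier_vertex K_complex aK))).
have ar : a \in r by have := Hr r rK ry; rewrite fsub1set.
apply: contrapT => H.
have le_a v : v \in r -> v 0 0 <= a 0 0.
  move=> vr; rewrite leNgt; apply/negP => av; apply: H.
  by exists v => //; apply: (K_face2 K_complex rK).
have [c [c0 c1 yE]] := ry.
have : (a + k *: u) 0 0 <= a 0 0.
  rewrite yE summxE -[leRHS]mul1r -c1 mulr_suml big_seq [leRHS]big_seq.
  by apply: ler_sum => v vr; rewrite mxE ler_wpM2l ?c0 ?le_a.
by rewrite !mxE eqxx mulr1 gerDl leNgt k0.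
Qed.

Definition star v x := body K x /\ forall s, s \in K -> hull s x -> v \in s.

Lemma star_carrier s v x : carrier K s x -> v \in s -> star v x.
Proof.
move=> cx vs; split; first exact: carrier_body cx.
by case: cx => _ _ sm t tK tx; apply: (fsubsetP (sm t tK tx)).
Qed.

(** Moving from [x] towards the vertex [v] keeps all barycentric coordinates on
    the carrier of [x] positive, until [v] is reached. *)
Lemma star_seg v x : star v x -> seg v x `<=` star v.
Proof.
move=> [bx sx] y [k]; rewrite /= in_itv /= => /andP[k0 k1] yE.
have [s cs] := carrier_exists K_complex bx.
have [sK xs _] := cs; have vs := sx s sK xs.
have [k_eq0|k_neq0] := eqVneq k 0.
  have -> : y = v by rewrite -yE k_eq0 scale0r addr0.
  apply: (@star_carrier [fset v]%fset); last by rewrite inE.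
  exact/carrier_vertex/(K_face1 K_complex sK).
have kp : 0 < k by rewrite lt_neqAle eq_sym k_neq0.
apply: (@star_carrier s) => //.
have [_ [c [c0 c1 xE]] _] := cs; have cp := carrier_pos K_complex cs c0 c1 xE.
have delta (A : zmodType) (F : plane -> A) :
    \sum_(w <- s) (if w == v then F w else 0) = F v.
  rewrite (big_fsetD1 v) //= eqxx big_seq big1 ?addr0 // => w.
  by rewrite !inE => /andP[/negbTE ->].
apply: (@pos_carrier _ _ K_complex _ _
  (fun w => (if w == v then 1 - k else 0) + k * c w)) => //.
- move=> w ws; apply: ltr_wpDl; last by rewrite mulr_gt0 // cp.
  by case: ifP => // _; rewrite subr_ge0.
- by rewrite big_split /= delta -mulr_sumr c1 mulr1 subrK.
- transitivity (\sum_(w <- s) ((if w == v then (1 - k) *: w else 0) + k *: (c w *: w))).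
    rewrite big_split /= delta -scaler_sumr -xE -yE.
    by apply/rowP => i; rewrite !mxE; ring.
  apply: eq_bigr => w _; rewrite [RHS]scalerDl scalerA.
  by case: (w == v); rewrite ?scale0r.
Qed.

Lemma near_star v x : star v x -> \forall y \near x, body K y -> star v y.
Proof.
move=> [_ sx]; apply: filterS (near_hull K_complex x) => y Hy yb.
by split => // s sK ys; apply: sx => //; exact: Hy.
Qed.

End Stars.

(** * Complexes whose body is a disc *)

Lemma within_near (R : realType) (A : set 'rV[R]_2) (f : 'rV[R]_2 -> 'rV[R]_2) x
    (P : set 'rV[R]_2) :
  {within A, continuous f} -> A x -> nbhs (f x) P ->
  \forall y \near x, A y -> P (f y).
Proof.
move=> cf Ax Px; have := cf x P Px; rewrite nbhs_simpl /= => H.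
suff : within A (nbhs x) (f @^-1` P) by [].
by rewrite nbhs_subspace_in.
Qed.

Section Disc.
Variables (R : realType) (K : {fset (simplex R)}).
Hypothesis K_complex : is_complex K.
Hypothesis K_disc : homeomorphic (body K) (disc R).
Notation plane := 'rV[R]_2.
Implicit Types (a b c d x y v : plane) (s t u r e : simplex R).

(** A cocycle is the transition function of a covering of the body, trivial
    over the star of each vertex; pulled back to the disc, it has a section,
    which is constant on each star. *)
Lemma cocycle_coboundary (G : zmodType) (c : plane -> plane -> G) :
  (forall s (u v w : plane), s \in K -> u \in s -> v \in s -> w \in s ->
     c u w = c u v + c v w) ->
  exists phi : plane -> G, forall s (v w : plane), s \in K -> v \in s -> w \in s ->
    phi w = phi v + c v w.
Proof.
move=> cc; have [f [g [fD gB [gf _] fc gc]]] := K_disc.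
have fK x : body K x -> g (f x) = x by move=> bx; apply: gf; rewrite inE.
have [h [hloc htr]] : trivial_over (fun v p => star K v (g p)) c (disc R).
  apply: (@trivial_convex _ _ _ _ _ _ _ _ _ (-1) 1).
  - move=> v p Dp sp.
    have N := within_near gc Dp (near_star K_complex sp).
    by apply: filterS N => q H Dq; apply: H => //; exact: gB.
  - move=> p Dp; have [s cs] := carrier_exists K_complex (gB _ Dp).
    have [sK _ _] := cs; have /fset0Pn[v vs] := K_neq0 K_complex sK.
    by exists v; apply: star_carrier cs _.
  - move=> u v w p Dp [[s sK sp] su] [_ sv] [_ sw].
    by apply: (cc s) => //; [exact: su|exact: sv|exact: sw].
  - exact: disc_closed.
  - exact: disc_convex.
  - move=> p; rewrite /disc /= => Hp; split; nra.
have const v x : star K v x -> h v (f x) = h v (f v).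
  move=> sx; apply: (locally_constant_connected (@seg_connected R v x)
      (g := fun y => h v (f y))); [|exact: seg_r|exact: seg_l].
  move=> y ys; have [yb ystar] := star_seg K_complex sx ys.
  have svy : star K v (g (f y)) by rewrite fK.
  have N := within_near fc yb (hloc v (f y) (fD _ yb) svy).
  apply: filterS N => z Hz zs.
  have [zb _] := star_seg K_complex sx zs.
  by apply: Hz => //; exact: fD.
exists (fun v => h v (f v)) => s v w sK vs ws.
have [x cx] := carrier_point K_complex sK.
have bx := carrier_body cx.
have sv := star_carrier cx vs; have sw := star_carrier cx ws.
rewrite -(const v x) // -(const w x) //.
by apply: htr; rewrite ?fK //; exact: fD.
Qed.

Lemma body_minus_finite_connected (F : seq plane) :
  (forall x, x \in F -> body K x) -> connected (body K `\` [set` F]).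
Proof.
move=> FB; have [f [g [fD gB [gf fg] fc gc]]] := K_disc.
have fK x : body K x -> g (f x) = x by move=> bx; apply: gf; rewrite inE.
have gK p : disc R p -> f (g p) = p by move=> Dp; apply: fg; rewrite inE.
have -> : body K `\` [set` F] = g @` (disc R `\` [set` map f F]).
  apply/seteqP; split => x.
    move=> [bx nF]; exists (f x); last exact: fK.
    split; first exact: fD.
    move=> /= /mapP[y yF fxy]; apply: nF => /=.
    by rewrite -(fK x bx) fxy fK //; exact: FB.
  move=> [p [Dp nF] <-]; split; first exact: gB.
  by move=> /= gF; apply: nF => /=; rewrite -(gK p Dp); exact: map_f.
apply: connected_continuous_connected; first exact: disc_minus_finite_connected.
by apply: continuous_subspaceW gc; exact: subIsetl.
Qed.

Definition vertices : seq plane := flatten [seq enum_fset s | s <- enum_fset K].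

Lemma verticesP x : reflect ([fset x]%fset \in K) (x \in vertices).
Proof.
apply: (iffP flattenP) => [[_ /mapP[s sK ->] xs]|xK].
  exact: (K_face1 K_complex sK).
by exists (enum_fset [fset x]%fset); [exact: map_f|rewrite inE].
Qed.

Lemma carrier_not_vertex s x : carrier K s x -> x \notin vertices ->
  (1 < #|` s|)%N.
Proof.
move=> cx nx; rewrite ltnNge; apply/negP => s1.
have sE := carrier_card1 K_complex cx s1.
by case/negP: nx; apply/verticesP; rewrite -sE; case: cx.
Qed.

Lemma not_vertex s x : carrier K s x -> (1 < #|` s|)%N -> x \notin vertices.
Proof.
move=> [_ _ sm] s1; apply/negP => /verticesP xK.
have := fsubset_leq_card (sm _ xK (hull_vertex (fset11 x))).
by rewrite cardfs1 leqNgt s1.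
Qed.

Lemma vertices_body x : x \in vertices -> body K x.
Proof.
by move/verticesP => xK; apply: (body_hull xK); apply: hull_vertex; rewrite inE.
Qed.

(** The body minus the vertices is connected, and the triangles that can be
    reached from a given one through interior edges form a relatively clopen
    part of it. *)
Lemma triangles_connected (S : simplex R -> Prop) :
  (exists t, [/\ t \in K, #|` t| = 3%N & S t]) ->
  (forall e t t', e \in K -> #|` e| = 2%N -> e \notin boundary K ->
     t \in K -> #|` t| = 3%N -> (e `<=` t)%fset ->
     t' \in K -> #|` t'| = 3%N -> (e `<=` t')%fset -> S t -> S t') ->
  forall t, t \in K -> #|` t| = 3%N -> S t.
Proof.
move=> [t0 [t0K t03 St0]] HS t1 t1K t13.
pose S' t := #|` t| = 3%N /\ S t.
suff SUB : body K `\` [set` vertices] `<=`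
    [set y | exists r, [/\ r \in K, S' r & hull r y]].
  have [x cx] := carrier_point K_complex t1K.
  have [r [rK [r3 Sr] rx]] : exists r, [/\ r \in K, S' r & hull r x].
    apply: SUB; split; first exact: carrier_body cx.
    by apply/negP; apply: (not_vertex cx); rewrite t13.
  have [_ _ xm] := cx.
  by rewrite (card3_eq K_complex t1K rK t13 (xm r rK rx)).
apply: connected_clopen; first exact: body_minus_finite_connected vertices_body.
- have [x cx] := carrier_point K_complex t0K; exists x.
    split; first exact: carrier_body cx.
    by apply/negP; apply: (not_vertex cx); rewrite t03.
  by exists t0; case: cx.
- move=> x [bx /= /negP nx] [t [tK [t3 St] tx]].
  have [s cx] := carrier_exists K_complex bx.
  have s1 := carrier_not_vertex cx nx.
  have [sK sx sm] := cx; have st := sm t tK tx.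
  have S't : S' t by [].
  have N : \forall y \near x, body K y ->
      exists r, [/\ r \in K, S' r & hull r y].
    apply: (triangles_near K_complex cx s1 tK S't tx) => r rK r3 sr; split => //.
    have [s3|s3] := eqVneq #|` s| 3%N.
      by rewrite -(card3_eq K_complex sK rK s3 sr) (card3_eq K_complex sK tK s3 st).
    have [[v sE]|[a [b [ab sE]]]|/eqP] := cards_cases K_complex sK.
    + by rewrite sE cardfs1 in s1.
    + have [sb|sb] := boolP (s \in boundary K); last first.
        by apply: (HS s t r) => //; rewrite sE cardfs2 ab.
      rewrite sE in sb st sr.
      by rewrite -(boundary_edge_triangle K_complex ab sb tK t3 st rK r3 sr).
    + by rewrite (negbTE s3).
  by apply: filterS N => y H [yb _]; exact: H.
- move=> x _ nB; apply: filterS (near_hull K_complex x) => y Hy _ [r [rK Sr ry]].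
  by apply: nB; exists r; split => //; exact: Hy.
Qed.

(** Without triangles the body minus the vertices would be a union of open
    edges; removing the midpoint of one of them disconnects it. *)
Lemma triangle_exists : exists2 t, t \in K & #|` t| = 3%N.
Proof.
apply: contrapT => nT; have [f [g [fD gB [gf fg] fc gc]]] := K_disc.
have [x bx nx] : exists2 x, body K x & x \notin vertices.
  have [k /andP[k0 k1] kf] := avoid_finite [seq f v 0 0 | v <- vertices] (ltr01 : 0 < 1 :> R).
  pose p : plane := \row_i (if i == 0 then k else 0).
  have Dp : disc R p by rewrite /disc /= !mxE /=; nra.
  exists (g p); first exact: gB.
  apply: contraNN kf => gv; apply/mapP; exists (g p) => //.
  by rewrite fg ?inE // mxE.
have [s cx] := carrier_exists K_complex bx.
have s1 := carrier_not_vertex cx nx; have [sK _ _] := cx.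
have [[v sE]|[a [b [ab sE]]]|s3] := cards_cases K_complex sK.
- by rewrite sE cardfs1 in s1.
- rewrite sE in sK.
  pose N : R := (b 0 0 - a 0 0) ^+ 2 + (b 0 1 - a 0 1) ^+ 2.
  have N0 : N != 0 by rewrite gt_eqF // sqdist_gt0 //; exact/eqP.
  pose l (y : plane) : R := (b 0 0 - a 0 0) / N * y 0 0 + (b 0 1 - a 0 1) / N * y 0 1
    + - ((b 0 0 - a 0 0) / N * a 0 0 + (b 0 1 - a 0 1) / N * a 0 1).
  have lE k : l (a + k *: (b - a)) = k.
    by rewrite /l !line_coord; move: N0; rewrite /N => N0; field.
  have lc : continuous l by exact: affine_cts.
  pose m := a + 2^-1 *: (b - a).
  have open_edge k : 0 < k < 1 -> carrier K [fset a; b]%fset (a + k *: (b - a)).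
    by move=> hk; apply/(carrier_edge K_complex _ ab sK); exists k.
  have m01 : 0 < (2^-1 : R) < 1 by apply/andP; split; lra.
  have FB y : y \in m :: vertices -> body K y.
    rewrite inE => /orP[/eqP ->|]; first exact: carrier_body (open_edge _ m01).
    exact: vertices_body.
  have edge_pt k : 0 < k < 1 -> k != 2^-1 ->
      (body K `\` [set` m :: vertices]) (a + k *: (b - a)).
    move=> hk km; split; first exact: carrier_body (open_edge k hk).
    rewrite /= inE => /orP[/eqP/(congr1 l)|].
      by rewrite !lE => kE; rewrite kE eqxx in km.
    by apply/negP; apply: (not_vertex (open_edge k hk)); rewrite cardfs2 ab.
  have SUB : body K `\` [set` m :: vertices] `<=`
      [set y | hull [fset a; b]%fset y /\ l y < 2^-1].
    apply: connected_clopen; first exact: body_minus_finite_connected FB.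
    + have h : 0 < (4^-1 : R) < 1 by apply/andP; split; lra.
      exists (a + 4^-1 *: (b - a)); first by apply: edge_pt => //; apply/eqP; lra.
      split; last by rewrite lE; lra.
      by case: (open_edge _ h).
    + move=> y [yb /= ny] [ye ly].
      have [r cy] := carrier_exists K_complex yb.
      have r1 : (1 < #|` r|)%N.
        apply: carrier_not_vertex cy _; apply/negP => yv; apply: ny.
        by rewrite inE yv orbT.
      have [rK _ rm] := cy.
      have rE : r = [fset a; b]%fset.
        by apply/eqP; rewrite eqEfcard (rm _ sK ye) cardfs2 ab.
      have H1 := near_carrier K_complex cy; have H2 := near_fun_lt lc ly.
      near=> z => -[[q qK qz] _]; split; last by near: z.
      have rq : (r `<=` q)%fset by have := near H1 z; apply.
      suff <- : q = [fset a; b]%fset by [].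
      rewrite rE in rq; apply/eqP; rewrite eq_sym eqEfcard rq cardfs2 ab /=.
      rewrite -ltnS ltn_neqAle (K_card K_complex qK) andbT.
      by apply/eqP => q3; apply: nT; exists q.
    + move=> y [yb /= ny] nB.
      have [ye|nye] := pselect (hull [fset a; b]%fset y); last first.
        have N1 := near_hull K_complex y.
        by apply: filterS N1 => z Hz _ [ze _]; apply: nye; exact: Hz.
      have ly : 2^-1 < l y.
        have [k _ yE] := (hull2 _ ab).1 ye.
        rewrite lt_neqAle leNgt; apply/andP; split; last first.
          by apply/negP => h; apply: nB.
        apply/eqP => h; apply: ny; rewrite inE; apply/orP; left.
        by rewrite -yE lE in h; rewrite -yE -h.
      have H := near_fun_gt lc ly.
      by apply: filterS H => z zl _ [_ h]; have := lt_trans h zl; rewrite ltxx.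
  have h : 0 < (3 / 4 : R) < 1 by apply/andP; split; lra.
  have [_] : hull [fset a; b]%fset (a + (3 / 4) *: (b - a)) /\
      l (a + (3 / 4) *: (b - a)) < 2^-1.
    by apply: SUB; apply: edge_pt => //; apply/eqP; lra.
  by rewrite lE; lra.
- by apply: nT; exists s.
Unshelve. all: by end_near. Qed.

End Disc.

(** * Counting in an exact sequence *)

Section LinearAlgebra.
Variables (F : fieldType) (T E V : finType).

Lemma sum_enum_rank (A : zmodType) (I : finType) (f : 'I_#|I| -> A) :
  \sum_i f i = \sum_x f (enum_rank x).
Proof. exact/reindex/onW_bij/enum_rank_bij. Qed.

Definition rel_mx (I J : finType) (d : I -> J -> F) : 'M[F]_(#|I|, #|J|) :=
  \matrix_(i, j) d (enum_val i) (enum_val j).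

(** Solvability of a linear system, tested on the solutions of the dual one. *)
Lemma linear_duality (d : T -> E -> F) (u : E -> F) :
  (forall y : E -> F, (forall t, \sum_e d t e * y e = 0) -> \sum_e u e * y e = 0) ->
  exists f : T -> F, forall e, u e = \sum_t f t * d t e.
Proof.
move=> H; pose U : 'rV[F]_#|E| := \row_j u (enum_val j).
have /submxP[W WE] : (U <= rel_mx d)%MS.
  rewrite submxE; apply/eqP/matrixP => i k; rewrite !mxE sum_enum_rank.
  transitivity (\sum_e u e * cokermx (rel_mx d) (enum_rank e) k).
    by apply: eq_bigr => e _; rewrite mxE enum_rankK.
  apply: H => t.
  have /matrixP/(_ (enum_rank t) k) := mulmx_coker (rel_mx d).
  rewrite !mxE sum_enum_rank => E0; rewrite -[RHS]E0.
  by apply: eq_bigr => e _; rewrite !mxE !enum_rankK.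
exists (fun t => W 0 (enum_rank t)) => e.
have /matrixP/(_ 0 (enum_rank e)) := WE.
rewrite !mxE enum_rankK sum_enum_rank => ->.
by apply: eq_bigr => t _; rewrite !mxE !enum_rankK.
Qed.

(** The alternating count of the terms of a complex
    [F^T -> F^E -> F^V] that is exact except for a one-dimensional kernel on
    the left. *)
Lemma exact_count (d2 : T -> E -> F) (d1 : E -> V -> F) (t0 : T) :
  (forall f : T -> F, (forall e, \sum_t f t * d2 t e = 0) -> forall t, f t = f t0) ->
  (forall e, \sum_t d2 t e = 0) ->
  (forall g : V -> F, (forall e, \sum_v d1 e v * g v = 0) -> forall v, g v = 0) ->
  (forall t v, \sum_e d2 t e * d1 e v = 0) ->
  (forall z : E -> F, (forall v, \sum_e z e * d1 e v = 0) ->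
     exists f : T -> F, forall e, z e = \sum_t f t * d2 t e) ->
  (#|V| + #|T| = #|E| + 1)%N.
Proof.
move=> Hker Hconst Hsurj Hdd Hex.
set M2 := rel_mx d2; set M1 := rel_mx d1.
have r1 : \rank M1 = #|V|.
  have c0 : cokermx M1 = 0.
    apply/matrixP => i k; rewrite [RHS]mxE -[i]enum_valK.
    apply: (Hsurj (fun v => cokermx M1 (enum_rank v) k)) => e.
    have /matrixP/(_ (enum_rank e) k) := mulmx_coker M1.
    rewrite !mxE sum_enum_rank => E0; rewrite -[RHS]E0.
    by apply: eq_bigr => v _; rewrite !mxE !enum_rankK.
  have := mxrank_coker M1; rewrite c0 mxrank0 => /esym/eqP; rewrite subn_eq0 => h.
  by apply/eqP; rewrite eqn_leq rank_leq_col.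
have r2 : \rank (kermx M2) = 1%N.
  pose W : 'rV[F]_#|T| := const_mx 1.
  have W0 : W != 0.
    apply/eqP => /matrixP/(_ 0 (enum_rank t0)); rewrite !mxE => /eqP.
    by rewrite oner_eq0.
  have <- : \rank W = 1%N by rewrite rank_rV W0.
  apply/eqP; rewrite eqn_leq; apply/andP; split; apply: mxrankS.
    apply/row_subP => i; set w := row i _.
    have /sub_kermxP/matrixP w0 : (w <= kermx M2)%MS by exact: row_sub.
    have -> : w = w 0 (enum_rank t0) *: W; last exact: scalemx_sub.
    apply/rowP => j; rewrite !mxE mulr1 -[j]enum_valK.
    have := Hker (fun t => w 0 (enum_rank t)) _ (enum_val j); rewrite !mxE; apply => e.
    have := w0 0 (enum_rank e); rewrite !mxE sum_enum_rank => E0; rewrite -[RHS]E0.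
    by apply: eq_bigr => t _; rewrite !mxE !enum_rankK.
  apply/sub_kermxP/matrixP => i j; rewrite !mxE sum_enum_rank -[RHS](Hconst (enum_val j)).
  by apply: eq_bigr => t _; rewrite !mxE mul1r enum_rankK.
have r12 : \rank M2 = \rank (kermx M1).
  apply/eqP; rewrite eqn_leq; apply/andP; split; apply: mxrankS.
    apply/sub_kermxP/matrixP => i j; rewrite !mxE sum_enum_rank.
    rewrite -[RHS](Hdd (enum_val i) (enum_val j)).
    by apply: eq_bigr => e _; rewrite !mxE enum_rankK.
  apply/row_subP => i; set w := row i _.
  have /sub_kermxP/matrixP w0 : (w <= kermx M1)%MS by exact: row_sub.
  have [v|f Hf] := Hex (fun e => w 0 (enum_rank e)).
    have := w0 0 (enum_rank v); rewrite !mxE sum_enum_rank => E0; rewrite -[RHS]E0.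
    by apply: eq_bigr => e _; rewrite !mxE !enum_rankK.
  have -> : w = (\row_i f (enum_val i)) *m M2; last exact: submxMl.
  apply/rowP => j; rewrite -[j]enum_valK Hf !mxE sum_enum_rank.
  by apply: eq_bigr => t _; rewrite !mxE !enum_rankK.
have := mxrank_ker M2; have := mxrank_ker M1; have := rank_leq_row M1.
rewrite r1 r2 -r12; have := rank_leq_row M2; lia.
Qed.

End LinearAlgebra.

(** * The relative chain complex modulo 2 *)

Section Counting.
Variables (R : realType) (K : {fset (simplex R)}).
Hypothesis K_complex : is_complex K.
Hypothesis K_disc : homeomorphic (body K) (disc R).
Notation plane := 'rV[R]_2.
Implicit Types (a b c x y : plane) (s r : simplex R).

Definition interior_simplices (d : nat) : {fset (simplex R)} :=
  [fset s in K | (s \notin boundary K) && (#|` s| == d.+1)]%fset.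

Local Notation V := (interior_simplices 0).
Local Notation E := (interior_simplices 1).
Local Notation T := (interior_simplices 2).
Local Notation F2 := 'F_2.

Lemma interior_simplicesP (d : nat) s : s \in interior_simplices d <->
  [/\ s \in K, s \notin boundary K & #|` s| = d.+1].
Proof.
rewrite !inE /=; split; first by move=> /and3P[-> -> /eqP ->].
by move=> [-> -> ->]; rewrite eqxx.
Qed.

Lemma F2P (x : F2) : x = 0 \/ x = 1.
Proof. by case: x => [[|[|//]] Hi]; [left|right]; apply/val_inj. Qed.

Lemma addrr2 (x : F2) : x + x = 0.
Proof. by case: (F2P x) => ->; apply/val_inj. Qed.

Lemma addr2_eq0 (x y : F2) : x + y = 0 -> x = y.
Proof. by move=> h; rewrite -[x]addr0 -(addrr2 y) addrA h add0r. Qed.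

Definition inc s r : F2 := (r `<=` s)%fset%:R.

Lemma inc1 s r : (r `<=` s)%fset -> inc s r = 1.
Proof. by rewrite /inc => ->. Qed.

Lemma inc0 s r : ~~ (r `<=` s)%fset -> inc s r = 0.
Proof. by rewrite /inc => /negbTE ->. Qed.

Lemma TP (t : T) : val t \in K /\ #|` val t| = 3%N.
Proof. by have /interior_simplicesP[? _ ?] := valP t. Qed.

Lemma EP (e : E) : [/\ val e \in K, val e \notin boundary K & #|` val e| = 2%N].
Proof. exact/interior_simplicesP/valP. Qed.

Lemma VP (v : V) : exists a, [/\ val v = [fset a]%fset, [fset a]%fset \in K
  & [fset a]%fset \notin boundary K].
Proof.
have /interior_simplicesP[vK vb v1] := valP v.
have /eqP/cardfs1P[a vE] := v1.
by exists a; rewrite -vE.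
Qed.

Lemma triangle_T t : t \in K -> #|` t| = 3%N -> exists t' : T, val t' = t.
Proof.
move=> tK t3; have tT : t \in T.
  by apply/interior_simplicesP; split => //; exact: triangle_not_boundary.
by exists [` tT]%fset.
Qed.

Lemma edge_sum (e : E) : exists t1 t2 : T,
  [/\ (val e `<=` val t1)%fset, (val e `<=` val t2)%fset,
      forall t : T, (val e `<=` val t)%fset -> t = t1 \/ t = t2
    & forall f : T -> F2, \sum_t f t * inc (val t) (val e) = f t1 + f t2].
Proof.
have [eK eb e2] := EP e; have [a [b [ab eE]]] := edge_pair e2.
rewrite eE in eK eb; have [c [d [[cK c3] [dK d3] cd Hcd _]]] :=
  interior_edge_triangles K_complex ab eK eb.
have [t1 E1] := triangle_T cK c3; have [t2 E2] := triangle_T dK d3.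
have s1 : (val e `<=` val t1)%fset by rewrite E1 eE fsubsetUl.
have s2 : (val e `<=` val t2)%fset by rewrite E2 eE fsubsetUl.
have H (t : T) : (val e `<=` val t)%fset -> t = t1 \/ t = t2.
  have [tK t3] := TP t; rewrite eE => et.
  by have [h|h] := Hcd _ tK t3 et; [left|right]; apply/val_inj; rewrite /= h ?E1 ?E2.
exists t1, t2; split => // f.
have t21 : t2 != t1 by apply/eqP => h; rewrite h E1 in E2; rewrite E2 eqxx in cd.
rewrite (bigD1 t1) //= (bigD1 t2) //= !inc1 // !mulr1 big1 ?addr0 // => t /andP[n1 n2].
rewrite inc0 ?mulr0 //; apply/negP => /H [h|h].
  by rewrite h eqxx in n1.
by rewrite h eqxx in n2.
Qed.

Lemma interior_coface r s : r \in K -> s \in K -> r \notin boundary K ->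
  (r `<=` s)%fset -> s \notin boundary K.
Proof. by move=> rK sK rb rs; apply: contra rb => sb; exact: boundary_face rs. Qed.

Lemma edge_E e a : e \in K -> #|` e| = 2%N -> a \in e -> [fset a]%fset \notin boundary K ->
  exists e' : E, val e' = e.
Proof.
move=> eK e2 ae ab; have eE : e \in E.
  apply/interior_simplicesP; split => //; apply: (@interior_coface [fset a]%fset) => //.
    exact: (K_face1 K_complex eK).
  by rewrite fsub1set.
by exists [` eE]%fset.
Qed.

(** A chain with boundary zero takes the same value on the two triangles at
    each interior edge. *)
Lemma cycle_constant (f : T -> F2) (t0 : T) :
  (forall e : E, \sum_t f t * inc (val t) (val e) = 0) -> forall t, f t = f t0.
Proof.
move=> Hf t.
suff : forall s, s \in K -> #|` s| = 3%N -> forall t : T, val t = s -> f t = f t0.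
  by have [tK t3] := TP t; move=> /(_ _ tK t3); apply.
apply: (triangles_connected K_complex K_disc).
  have [t0K t03] := TP t0; exists (val t0); split => // t' /val_inj -> //.
move=> e s s' eK e2 eb sK s3 es sK' s3' es' Hs t' tE'.
have eE : e \in E by apply/interior_simplicesP.
have [t1 [t2 [_ _ H12 Hsum]]] := edge_sum [` eE]%fset.
have := Hf [` eE]%fset; rewrite Hsum => /addr2_eq0 f12.
have [t'' tE''] := triangle_T sK s3.
rewrite -(Hs _ tE'').
have [->|->] : t' = t1 \/ t' = t2 by apply: H12; rewrite tE'.
  by have [->|->] : t'' = t1 \/ t'' = t2 by apply: H12; rewrite tE''.
by have [->|->] : t'' = t1 \/ t'' = t2 by apply: H12; rewrite tE''.
Qed.

(** The vertex of largest first coordinate in the support of [g] would have an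
    ascending edge whose other end carries the same value. *)
Lemma coboundary_injective (g : V -> F2) :
  (forall e : E, \sum_v inc (val e) (val v) * g v = 0) -> forall v, g v = 0.
Proof.
move=> Hg v0; apply/eqP; apply: contraT => g0.
have [pt ptE] : exists pt : V -> plane, forall v, val v = [fset pt v]%fset.
  have /choice[pt H] : forall v : V, exists a, val v = [fset a]%fset.
    by move=> v; have [a [vE _ _]] := VP v; exists a.
  by exists pt.
case: (@arg_maxP _ _ _ v0 (fun v => g v != 0) (fun v => pt v 0 0) g0) => v gv vmax.
have [a [vE aK ab]] := VP v.
have pva : pt v = a by apply/fset1P; rewrite -vE ptE inE.
have [b abK ab0] := ascending_edge K_complex aK ab.
have ab' : a != b by apply/eqP => h; rewrite h ltxx in ab0.
have [e eE] : exists e : E, val e = [fset a; b]%fset.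
  by apply: (@edge_E _ a) => //; rewrite ?cardfs2 ?ab' // !inE eqxx.
have := Hg e; rewrite (bigD1 v) //= big1 => [|w wv].
  by rewrite inc1 ?mul1r ?addr0 ?eE ?vE ?fsubsetUl // => /eqP; rewrite (negbTE gv).
have [/eqP ->|gw] := boolP (g w == 0); first by rewrite mulr0.
have := vmax w gw; rewrite pva => wa.
rewrite inc0 ?mul0r // eE ptE fsub1set !inE; apply/negP => /orP[/eqP h|/eqP h].
  by move: wv; rewrite -val_eqE /= ptE h vE eqxx.
by move: wa; rewrite h; move/(lt_le_trans ab0); rewrite ltxx.
Qed.

(** A triangle has two edges at each of its vertices. *)
Lemma boundary_boundary (t : T) (v : V) :
  \sum_(e : E) inc (val t) (val e) * inc (val e) (val v) = 0.
Proof.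
have [tK t3] := TP t; have [a [vE aK ab]] := VP v.
have [at_|nat] := boolP (a \in val t); last first.
  rewrite big1 // => e _; have [et|net] := boolP (val e `<=` val t)%fset; last first.
    by rewrite inc0 ?mul0r.
  rewrite [inc (val e) _]inc0 ?mulr0 // vE fsub1set.
  by apply: contra nat => /(fsubsetP et).
have [b [c [ab' ac bc tE]]] := triangle_at t3 at_.
have edge x : a != x -> x \in val t -> exists e : E, val e = [fset a; x]%fset.
  move=> ax xt; apply: (@edge_E _ a) => //; rewrite ?cardfs2 ?ax // ?inE ?eqxx //.
  exact: (K_face2 K_complex tK).
have [e1 E1] : exists e : E, val e = [fset a; b]%fset.
  by apply: edge => //; rewrite tE !inE eqxx orbT.
have [e2 E2] : exists e : E, val e = [fset a; c]%fset.
  by apply: edge => //; rewrite tE !inE eqxx orbT.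
have e21 : e2 != e1.
  apply/eqP => h; have : b \in val e2 by rewrite h E1 !inE eqxx orbT.
  by rewrite E2 !inE eq_sym (negbTE ab') (negbTE bc).
have s1 : (val e1 `<=` val t)%fset by rewrite E1 tE fsubsetUl.
have s2 : (val e2 `<=` val t)%fset.
  by rewrite E2 tE fsubUset !fsub1set !inE !eqxx !orbT.
rewrite (bigD1 e1) //= (bigD1 e2) //= !inc1 ?E1 ?E2 ?vE ?fsub1set ?inE ?eqxx //.
all: rewrite -?E1 -?E2 //.
rewrite big1 => [|e /andP[n1 n2]]; first by apply/val_inj.
have [_ _ ec] := EP e.
have [et|net] := boolP (val e `<=` val t)%fset; last by rewrite inc0 ?mul0r.
rewrite [inc (val e) _]inc0 ?mulr0 // fsub1set; apply/negP => ae.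
rewrite tE in et.
have [h|h] := edge_of_triangle ec ae et.
  by move: n1; rewrite -val_eqE /= h E1 eqxx.
by move: n2; rewrite -val_eqE /= h E2 eqxx.
Qed.

(** In the star of [a] a 1-cycle [z] bounds: by duality it suffices that [z] is
    orthogonal to the cochains [y] on the edges at [a] that vanish on all
    triangles at [a]. The support of such a [y] is closed under adjacency, hence
    empty or the set of all edges at an interior vertex [a]; in the second case
    orthogonality is the cycle condition at [a]. *)
Lemma local_potential (z : E -> F2) a : [fset a]%fset \in K ->
  (forall v : V, \sum_e z e * inc (val e) (val v) = 0) ->
  exists P : T -> F2, forall e : E, a \in val e ->
    z e = \sum_t P t * inc (val t) (val e).
Proof.
move=> aK Hz.
have [|P HP] := @linear_duality _ T E
  (fun t e => if a \in val e then inc (val t) (val e) else 0)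
  (fun e => if a \in val e then z e else 0); last first.
  exists P => e ae; have := HP e; rewrite ae => ->.
  by apply: eq_bigr.
move=> y Hy.
pose Y s := exists e : E, [/\ val e = s, a \in s & y e != 0].
have [HY|HY] := pselect (exists s, Y s); last first.
  rewrite big1 // => e _; case: ifP => [ae|_]; last by rewrite mul0r.
  have [/eqP ->|ye] := boolP (y e == 0); first by rewrite mulr0.
  by exfalso; apply: HY; exists (val e), e.
have [||ab Yall] := star_transitive K_complex aK HY.
- by move=> _ [e [<- ae _]]; have [eK eb e2] := EP e.
- move=> s e e' sK s3 es es' e2' ae' [eE [eEv ae ye]].
  have [eqe|nee] := eqVneq e' e; first by rewrite eqe; exists eE.
  apply: contrapT => nY; case/negP: ye; apply/eqP.
  have [t tE] := triangle_T sK s3.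
  have := Hy t; rewrite (bigD1 eE) //= eEv ae inc1 ?tE // mul1r big1 ?addr0 // => f fe.
  case: ifP => [af|_]; last by rewrite mul0r.
  have [fs|nfs] := boolP (val f `<=` val t)%fset; last by rewrite -tE inc0 // mul0r.
  have [/eqP ->|yf] := boolP (y f == 0); first by rewrite mulr0.
  exfalso; apply: nY; exists f; split => //.
  have [_ _ f2] := EP f; have [_ _ ec2] := EP eE.
  have as_ : a \in s by apply: (fsubsetP es).
  have [b [c [_ _ _ sE]]] := triangle_at s3 as_.
  rewrite eEv in ec2; rewrite tE sE in fs; rewrite sE in es es'.
  have nfe : val f <> e by rewrite -eEv => /val_inj h; rewrite h eqxx in fe.
  have [h1|h1] := edge_of_triangle f2 af fs;
  have [h2|h2] := edge_of_triangle ec2 ae es;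
  have [h3|h3] := edge_of_triangle e2' ae' es' => //;
  by [rewrite h1 h3|case: nfe; rewrite h1 h2|case/eqP: nee; rewrite h2 h3].
have aV : [fset a]%fset \in V by apply/interior_simplicesP; rewrite cardfs1.
rewrite -[RHS](Hz [` aV]%fset); apply: eq_bigr => e _ /=.
have [eK eb e2] := EP e.
case: ifP => ae; last by rewrite mul0r inc0 ?mulr0 // fsub1set ae.
rewrite inc1 ?fsub1set //; have [e' [ee' _ ye]] := Yall _ eK e2 ae.
by move: ye; rewrite (val_inj ee'); case: (F2P (y e)) => ->; rewrite ?eqxx.
Qed.

(** The differences of the local potentials at the two ends of an edge form a
    cocycle of [K]; correcting by a primitive makes the local potentials agree. *)
Lemma cycle_bounds (z : E -> F2) :
  (forall v : V, \sum_e z e * inc (val e) (val v) = 0) ->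
  exists f : T -> F2, forall e : E, z e = \sum_t f t * inc (val t) (val e).
Proof.
move=> Hz.
have /choice[P HP] : forall a, exists P : T -> F2, [fset a]%fset \in K ->
    forall e : E, a \in val e -> z e = \sum_t P t * inc (val t) (val e).
  move=> a; have [aK|naK] := boolP ([fset a]%fset \in K); last first.
    by exists (fun=> 0).
  by have [P HP] := local_potential aK Hz; exists P.
pose c v w : F2 :=
  if [pick t : T | (v \in val t) && (w \in val t)] is Some t then P v t + P w t else 0.
have cE (t : T) v w : v \in val t -> w \in val t -> c v w = P v t + P w t.
  move=> vt wt; rewrite /c; case: pickP => [t' /andP[vt' wt']|/(_ t)]; last by rewrite vt wt.
  have [->|vw] := eqVneq v w; first by rewrite !addrr2.
  have [tK t3] := TP t; have [tK' t3'] := TP t'.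
  have vwK : [fset v; w]%fset \in K by apply: (K_face2 K_complex tK).
  have s1 : ([fset v; w] `<=` val t)%fset by rewrite fsubUset !fsub1set vt wt.
  have s2 : ([fset v; w] `<=` val t')%fset by rewrite fsubUset !fsub1set vt' wt'.
  have [vwb|vwb] := boolP ([fset v; w]%fset \in boundary K).
    by rewrite (val_inj (boundary_edge_triangle K_complex vw vwb tK t3 s1 tK' t3' s2)).
  have vwE : [fset v; w]%fset \in E by apply/interior_simplicesP; rewrite cardfs2 vw.
  pose e : E := [` vwE]%fset.
  have [t1 [t2 [_ _ H12 Hs]]] := edge_sum e.
  have ve : v \in val e by rewrite !inE eqxx.
  have we : w \in val e by rewrite !inE eqxx orbT.
  have := HP v (K_face1 K_complex tK vt) e ve.
  rewrite (HP w (K_face1 K_complex tK wt) e we) !Hs.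
  move=> Hvw; have E12 : P v t1 + P w t1 = P v t2 + P w t2.
    by apply: addr2_eq0; rewrite addrACA -Hvw addrr2.
  by have [->|->] := H12 t s1; have [->|->] := H12 t' s2.
have c0 v w : (forall t : T, v \in val t -> w \in val t -> False) -> c v w = 0.
  by move=> H; rewrite /c; case: pickP => // t /andP[vt wt]; case: (H t).
have cvv v : c v v = 0 by rewrite /c; case: pickP => // t _; rewrite addrr2.
have [phi Hphi] : exists phi : plane -> F2, forall s (v w : plane),
    s \in K -> v \in s -> w \in s -> phi w = phi v + c v w.
  apply: (cocycle_coboundary K_complex K_disc) => s u v w sK us vs ws.
  have [[t [ut [vt wt]]]|nt] := pselect (exists t : T,
      u \in val t /\ v \in val t /\ w \in val t).
    by rewrite !(cE t) // addrA -(addrA (P u t)) addrr2 addr0.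
  have [<-|uv] := eqVneq u v; first by rewrite cvv add0r.
  have [<-|vw] := eqVneq v w; first by rewrite cvv addr0.
  have [uw|uw] := eqVneq u w.
    rewrite -uw cvv !c0 ?addr0 // => t h1 h2; apply: nt; exists t; by rewrite -uw.
  exfalso; apply: nt.
  have sub : ([fset u; v; w] `<=` s)%fset by rewrite !fsubUset !fsub1set us vs ws.
  have tK : [fset u; v; w]%fset \in K.
    by apply: (K_face K_complex sK) => //; apply/fset0Pn; exists u; rewrite !inE eqxx.
  have [t tE] := triangle_T tK (cardfs3 uv uw vw).
  by exists t; rewrite tE !inE !eqxx !orbT.
have /choice[pt ptP] : forall t : T, exists v, v \in val t.
  by move=> t; apply/fset0Pn/(K_neq0 K_complex); case: (TP t).
exists (fun t => P (pt t) t + phi (pt t)) => e.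
have fE (t : T) v : v \in val t -> P (pt t) t + phi (pt t) = P v t + phi v.
  move=> vt; have [tK _] := TP t; rewrite (Hphi _ _ _ tK (ptP t) vt) (cE t) //.
  by rewrite addrCA (addrC (P v t)) -addrA addrr2 addr0 addrC.
have [t1 [t2 [s1 s2 _ Hs]]] := edge_sum e; rewrite Hs.
have [eK _ _] := EP e; have /fset0Pn[v ve] := K_neq0 K_complex eK.
rewrite (fE t1 v) ?(fsubsetP s1) // (fE t2 v) ?(fsubsetP s2) //.
by rewrite addrACA addrr2 addr0 (HP v (K_face1 K_complex eK ve) e ve) Hs.
Qed.

Lemma interior_count : (#|` V| + #|` T| = #|` E| + 1)%N.
Proof.
have [t tK t3] := triangle_exists K_complex K_disc.
have [t0 _] := triangle_T tK t3.
rewrite !cardfE.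
apply: (@exact_count F2 T E V (fun t e => inc (val t) (val e))
  (fun e v => inc (val e) (val v)) t0).
- by move=> f Hf; exact: cycle_constant.
- move=> e; have [t1 [t2 [_ _ _ Hs]]] := edge_sum e.
  under eq_bigr do rewrite -[inc _ _]mul1r.
  by rewrite Hs addrr2.
- exact: coboundary_injective.
- exact: boundary_boundary.
- exact: cycle_bounds.
Qed.

End Counting.

(** * Identifications *)

Section Identified.
Variables (R : realType) (K : {fset (simplex R)}) (N : Type).
Variables (name : simplex R -> N) (tail head : simplex R -> 'rV[R]_2).
Hypothesis K_complex : is_complex K.
Hypothesis K_oriented : is_orientation K tail head.

(** The vertices identified by [id_tail] and [id_head] are faces of boundary
    edges, because [tail] and [head] are the ends of an edge. *)
Lemma identified_boundary s t : identified K name tail head s t ->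
  s = t \/ s \in boundary K /\ t \in boundary K.
Proof.
have ends e : boundary_edge K e ->
    [fset tail e]%fset \in boundary K /\ [fset head e]%fset \in boundary K.
  move=> eb; have eE := K_oriented eb; have [ebd _] := eb.
  have [eK _] := (boundaryP _ _).1 ebd.
  have te : tail e \in e by rewrite [in X in _ \in X]eE !inE eqxx.
  have he : head e \in e by rewrite [in X in _ \in X]eE !inE eqxx orbT.
  split; apply: (boundary_face ebd); rewrite ?fsub1set //;
    exact: (K_face1 K_complex eK).
elim=> {s t}.
- by left.
- by move=> s t _ [->|[]]; [left|right].
- by move=> s t u _ [->|[sb tb]] _ [<-|[tb' ub]]; [left|right|right|right].
- by move=> s t sb tb _ _; right.
- by move=> s t /ends[sb _] /ends[tb _] _; right.
- by move=> s t /ends[_ sb] /ends[_ tb] _; right.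
Qed.

(** The class of a simplex outside the boundary is a singleton. *)
Lemma nb_simplices_split d :
  nb_simplices K name tail head K d =
  (nb_simplices K name tail head (boundary K) d + #|` interior_simplices K d|)%N.
Proof.
rewrite /nb_simplices; pose cls s := [set t | identified K name tail head s t].
have clsP s t : cls s = cls t -> identified K name tail head s t.
  by move=> h; have := id_refl K name tail head t; rewrite -[identified _ _ _ _ _ _]/(cls t t) -h.
have -> : #|` interior_simplices K d| = #|` [fset cls s | s in interior_simplices K d]%fset|.
  apply/esym/card_in_imfset => s t /= /interior_simplicesP[_ sb _] _ /clsP.
  by case/identified_boundary => // -[]; rewrite (negbTE sb).
rewrite -cardfsUI.
set I := (_ `&` _)%fset; have -> : I = fset0.
  apply/eqP; rewrite -[_ == _]negbK; apply/negP => /fset0Pn[x].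
  rewrite inE => /andP[/imfsetP[s /= sb xs] /imfsetP[t /= /interior_simplicesP[_ tb _]]].
  rewrite xs => /clsP /identified_boundary [st|[_]]; last by rewrite (negbTE tb).
  by move: sb; rewrite inE /= st (negbTE tb).
rewrite cardfs0 addn0; congr #|` _|; apply/fsetP => x; rewrite inE.
apply/imfsetP/orP.
- move=> [s /=]; rewrite !inE => /andP[sK sd] ->.
  have [sb|sb] := boolP (s \in boundary K); [left|right]; apply/imfsetP; exists s => //=.
    by rewrite inE /= sb.
  by apply/interior_simplicesP; split => //; exact/eqP.
- move=> [|] /imfsetP[s /=].
    rewrite inE /= => /andP[sb sd] ->; exists s => //=.
    by rewrite inE /= sd andbT; have [] := (boundaryP _ _).1 sb.
  move=> /interior_simplicesP[sK _ sd] ->; exists s => //=.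
  by rewrite !inE sK sd eqxx.
Qed.

End Identified.

Theorem mainTheorem1 (R : realType) (K : {fset (simplex R)}) (N : Type)
    (name : simplex R -> N) (tail head : simplex R -> plane R)
    (K_complex : is_complex K)
    (K_disc : homeomorphic (body K) (disc R))
    (K_oriented : is_orientation K tail head) :
  euler_char K name tail head K
  = euler_char K name tail head (boundary K) + 1.
Proof.
rewrite /euler_char !nb_simplices_split //.
have := interior_count K_complex K_disc.
by move: #|` _| #|` _| #|` _| => n0 n2 n1; lia.
Qed.
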